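(* Let $g$ be a positive integer and let $G$ be a finite simple planar graph of girth at least $g$ with exactly $b$ bridges. Then $$F_{\max}(G) \leq \left\lfloor \frac{e(G)-b}{g}\right\rfloor.$$
   Context: For a graph $G$, $e(G)$ denotes its number of edges. $G$ has girth at least $g$ if every cycle of $G$ has length at least $g$ (a forest satisfies this for every $g$). For $X\subseteq V(G)$, $\delta_G(X)$ denotes the set of edges with exactly one end in $X$, called an edge cut; a bridge is an edge that by itself forms an edge cut. A signature on $G$ is a subset $\Sigma\subseteq E(G)$ (the set of negative edges); the pair $(G,\Sigma)$ is a signed graph. Two signatures $\Sigma,\Sigma'$ on $G$ are switching equivalent if $\Sigma'=\Sigma\,\Delta\,\delta_G(X)$ for some $X\subseteq V(G)$, where $\Delta$ is symmetric difference. The frustration index of $(G,\Sigma)$ is $F(G,\Sigma)=\min\{|\Sigma'|:\Sigma'\text{ is switching equivalent to }\Sigma\}$. The maximum frustration index of $G$ is $F_{\max}(G)=\max\{F(G,\Sigma):\Sigma\subseteq E(G)\}$. *)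

(* Defs.v *)
From HB Require Import structures.
From mathcomp Require Import all_boot all_order all_algebra.
From mathcomp Require Import all_classical all_reals all_analysis.

Set Implicit Arguments.
Unset Strict Implicit.
Unset Printing Implicit Defensive.

Import Order.TTheory GRing.Theory Num.Theory.
Import numFieldNormedType.Exports.

Record sgraph := SGraph {
  vertex :> finType;
  adj : rel vertex;
  adj_sym : symmetric adj;
  adj_irr : irreflexive adj }.

Section Graph.
Variable G : sgraph.

(* Since G is simple, an edge is identified with the set of its two ends. *)
Definition edges : {set {set G}} :=
  [set f | [exists x : G, exists y : G, adj x y && (f == [set x; y]%SET)]]%SET.

(* [ucycle] also accepts the closed walks x, y, x, hence the size condition. *)
Definition girth_ge (g : nat) : Prop :=
  forall c : seq G, ucycle (@adj G) c -> 2 < size c -> g <= size c.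

(* An edge has exactly one end in X iff it meets X in exactly one vertex. *)
Definition edge_cut (X : {set G}) : {set {set G}} :=
  [set f in edges | #|f :&: X| == 1]%SET.

Definition bridges : {set {set G}} :=
  [set f in edges | [exists X : {set G}, edge_cut X == [set f]%SET]]%SET.

Definition symdiff (A B : {set {set G}}) : {set {set G}} :=
  ((A :\: B) :|: (B :\: A))%SET.

Definition switching_equiv (S S' : {set {set G}}) : bool :=
  [exists X : {set G}, S' == symdiff S (edge_cut X)].

(* The default S of [arg min] is admissible: take X empty. *)
Definition frustration (S : {set {set G}}) : nat :=
  #|[arg min_(S' < S | switching_equiv S S') #|S'| ]|.

Definition max_frustration : nat :=
  \max_(S : {set {set G}} | S \subset edges) frustration S.

End Graph.

Local Open Scope classical_set_scope.
Local Open Scope ring_scope.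

(* [pos v] is the point representing the vertex v, and [arc f] parametrizes
   over [0, 1] the simple arc representing the edge f; the values of [arc f]
   outside [0, 1], and those of [arc] on non-edges, are irrelevant. *)
Record plane_drawing (R : realType) (G : sgraph)
    (pos : G -> R * R) (arc : {set G} -> R -> R * R) : Prop := PlaneDrawing {
  pos_inj : injective pos;
  arc_continuous : forall f, f \in edges G ->
    {within `[0, 1], continuous (arc f)};
  arc_inj : forall f, f \in edges G -> {in `[0, 1] &, injective (arc f)};
  arc_ends : forall f, f \in edges G -> exists x y : G,
    [/\ f = [set x; y]%SET, arc f 0 = pos x & arc f 1 = pos y];
  arc_avoids_vertices : forall f, f \in edges G ->
    forall (t : R) (v : G), t \in `]0, 1[ -> arc f t <> pos v;
  arcs_disjoint : forall f1 f2, f1 \in edges G -> f2 \in edges G -> f1 != f2 ->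
    forall t1 t2 : R, t1 \in `]0, 1[ -> t2 \in `]0, 1[ -> arc f1 t1 <> arc f2 t2 }.

Definition planar (R : realType) (G : sgraph) : Prop :=
  exists (pos : G -> R * R) (arc : {set G} -> R -> R * R), plane_drawing pos arc.

(* Main.v *)
Require Import Defs.
From mathcomp Require Import all_boot zify.

Set Implicit Arguments.
Unset Strict Implicit.
Unset Printing Implicit Defensive.

(** Switching a signature [S] adds a cut to it, so the task is to find a set
    [S'] that differs from [S] by a cut and is small.  In a plane graph, [S']
    differs from [S] by a cut exactly when both meet the boundary of every face
    in the same parity, that is, when [S'] is a [T]-join of the dual graph,
    where [T] consists of the faces with an odd number of negative edges.  The
    dual cuts are the even subgraphs of [G]; a [T]-odd dual cut is a nonempty
    one, so it contains a cycle, hence at least [g] edges, and none of them is a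
    bridge.  It remains to know that if every [T]-odd cut has at least [g]
    edges, then some [T]-join has at most a fraction [1/g] of all the edges
    ([tjoin]).  This is the integrality of the [T]-join polyhedron at the
    constant vector [1/g]; it is proved by the contraction argument of Sebo
    for bipartite graphs ([tjoin_bipartite]), to which subdividing every edge
    reduces the general case.

    The drawing consists of arbitrary continuous arcs.  Instead of studying its
    faces, which would need the Jordan curve theorem, one shows that [G] is a
    minor of a finite square grid ([planar_grid_minor]).  Each arc is cut into
    three thirds.  Two thirds that do not share a vertex or a cutting point are
    disjoint compact sets, so they are a positive distance apart, and on a fine
    enough grid the sets of corners of the squares that they visit are disjoint
    connected sets ([digitization]).  The outer thirds at a vertex make up its
    branch set; the middle third of an edge joins the two branch sets at its
    ends ([grid_minor_of_pieces]).

    In a grid, planar duality is explicit: the boundary of a set of squares is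
    even at every vertex ([dual_cut_even]), and an edge set that is even around
    every square is a cut ([grid_potential]).  The duality is then used through
    the minor ([grid_minor_switching]): in the dual of the grid, the grid edges
    deleted by the minor may be used at no cost, and those contracted by it may
    not be used. *)

(** * Boundaries modulo 2 of edge sets *)

Notation "\xor_ ( i | P ) F" := (\big[addb/false]_(i | P%B) F%B)
  (at level 41, F at level 41, i at level 50).
Notation "\xor_ ( i 'in' A ) F" := (\big[addb/false]_(i in A) F%B)
  (at level 41, F at level 41, i, A at level 50).

Definition symd (E : finType) (A B : {set E}) : {set E} :=
  [set e | (e \in A) (+) (e \in B)].

Section Symd.
Variable E : finType.
Implicit Types (A B C J P : {set E}) (F : E -> bool).

Lemma in_symd A B e : (e \in symd A B) = (e \in A) (+) (e \in B).
Proof. by rewrite inE. Qed.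

Lemma symdC A B : symd A B = symd B A.
Proof. by apply/setP => e; rewrite !inE addbC. Qed.

Lemma symdA A B C : symd A (symd B C) = symd (symd A B) C.
Proof. by apply/setP => e; rewrite !inE addbA. Qed.

Lemma symdK A B : symd A (symd A B) = B.
Proof. by apply/setP => e; rewrite !inE addbA addbb. Qed.

Lemma symd_sub A B C : A \subset C -> B \subset C -> symd A B \subset C.
Proof.
move=> /subsetP sA /subsetP sB; apply/subsetP => e; rewrite inE.
by case: (boolP (e \in A)) => [/sA //|_]; apply: sB.
Qed.

Lemma card_symd A B : #|symd A B| + #|A :&: B|.*2 = #|A| + #|B|.
Proof.
have -> : symd A B = (A :|: B) :\: (A :&: B).
  by apply/setP => e; rewrite !inE; case: (_ \in A); case: (_ \in B).
rewrite -cardsUI cardsD.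
have -> : (A :|: B) :&: (A :&: B) = A :&: B.
  by apply/setP => e; rewrite !inE; case: (_ \in A); case: (_ \in B).
have : #|A :&: B| <= #|A :|: B|.
  by apply: subset_leq_card; apply/subsetP => e; rewrite !inE => /andP[->].
lia.
Qed.

Lemma card_symd1_le A e : #|symd A [set e]| <= #|A|.+1.
Proof. have := card_symd A [set e]; rewrite cards1; lia. Qed.

Lemma card_symd1_in A e : e \in A -> #|symd A [set e]|.+1 = #|A|.
Proof.
move=> eA; have := card_symd A [set e].
have -> : A :&: [set e] = [set e].
  by apply/setP => f; rewrite !inE andbC; case: eqP => // ->; rewrite eA.
rewrite cards1; lia.
Qed.

(** Splitting [C] into [P] and the rest splits the change of size that
    exchanging along [C] causes in [J]. *)
Lemma card_symd_split J P C : P \subset C ->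
  #|symd J C| + #|J| = #|symd J P| + #|symd J (C :\: P)|.
Proof.
move=> PC; have := card_symd J C; have := card_symd J P.
have := card_symd J (C :\: P); have := cardsID P C.
have -> : C :&: P = P by apply/setIidPr.
have := cardsID P (J :&: C).
have -> : J :&: C :&: P = J :&: P by rewrite -setIA; congr setI; apply/setIidPr.
rewrite -setIDA; lia.
Qed.

Lemma odd_card A : odd #|A| = \xor_(e in A) true.
Proof.
by rewrite -sum1_card (big_morph odd oddD (erefl : odd 0 = false)).
Qed.

Lemma xor_symd A B F :
  \xor_(e in symd A B) F e = (\xor_(e in A) F e) (+) (\xor_(e in B) F e).
Proof.
rewrite big_mkcond [X in X (+) _]big_mkcond [X in _ (+) X]big_mkcond -big_split.
apply: eq_bigr => e _; rewrite in_symd.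
by case: (e \in A); case: (e \in B); rewrite /= ?addbF ?addbb.
Qed.

Lemma xor_exists (I : finType) (P : pred I) (F : I -> bool) :
  \xor_(e | P e) F e -> exists2 e, P e & F e.
Proof.
move=> H; have [/existsP[e /andP[]]|/existsPn N] := boolP [exists e, P e && F e].
  by exists e.
move: H; rewrite big1 // => e Pe; move: (N e); rewrite Pe /=.
by case: (F e).
Qed.

End Symd.

Lemma xor_delta (V : finType) (U : pred V) (a : V) :
  \xor_(v | U v) (v == a) = U a.
Proof.
rewrite big_mkcond (bigD1 a) //= eqxx big1 => [|v /negbTE ->].
  by rewrite addbF; case: (U a).
by case: (U v).
Qed.

Section Boundary.
Variables (V E : finType) (s t : E -> V).
Implicit Types (D J C P : {set E}) (T U : pred V) (e : E).

Definition bd J (v : V) : bool := \xor_(e in J) ((s e == v) (+) (t e == v)).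
Definition crossing D U : {set E} := [set e in D | U (s e) (+) U (t e)].
Definition parity T U : bool := \xor_(v | U v) T v.

Lemma in_crossing D U e :
  (e \in crossing D U) = (e \in D) && (U (s e) (+) U (t e)).
Proof. by rewrite inE. Qed.

Lemma bd_symd J C v : bd (symd J C) v = bd J v (+) bd C v.
Proof. exact: xor_symd. Qed.

Lemma bd_set1 e v : bd [set e] v = (v == s e) (+) (v == t e).
Proof. by rewrite /bd big_set1 ![v == _]eq_sym. Qed.

Lemma bd_set0 v : bd set0 v = false.
Proof. by rewrite /bd big_set0. Qed.

Lemma bd_diff J C v : C \subset J -> bd (J :\: C) v = bd J v (+) bd C v.
Proof.
move=> CJ; rewrite -bd_symd; congr (bd _ v); apply/setP => e; rewrite !inE.
case: (boolP (e \in C)) => [/(subsetP CJ) -> //|_]; by rewrite addbF.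
Qed.

Lemma bd_incident J v : bd J v -> exists2 e, e \in J & (v == s e) (+) (v == t e).
Proof. by move=> /xor_exists[e eJ H]; exists e => //; rewrite ![v == _]eq_sym. Qed.

Lemma bd_avoid J v : (forall e, e \in J -> (s e != v) && (t e != v)) ->
  bd J v = false.
Proof.
by move=> H; rewrite /bd big1 // => e /H /andP[/negbTE -> /negbTE ->].
Qed.

Lemma parity_bd J U : parity (bd J) U = \xor_(e in J) (U (s e) (+) U (t e)).
Proof.
rewrite /parity exchange_big /=; apply: eq_bigr => e _.
rewrite big_split /=; congr (_ (+) _).
- by rewrite -(xor_delta U (s e)); apply: eq_bigr => v _; rewrite eq_sym.
- by rewrite -(xor_delta U (t e)); apply: eq_bigr => v _; rewrite eq_sym.
Qed.

Lemma parity_bd_closed J U : crossing J U = set0 -> parity (bd J) U = false.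
Proof.
move=> J0; rewrite parity_bd big1 // => e eJ.
by move/setP/(_ e): J0; rewrite !inE eJ.
Qed.

Lemma parity1 T a : parity T (pred1 a) = T a.
Proof. by rewrite /parity big_pred1_eq. Qed.

Lemma parity_addb T T' U :
  parity (fun v => T v (+) T' v) U = parity T U (+) parity T' U.
Proof. by rewrite /parity big_split. Qed.

Lemma eq_parity T T' U : T =1 T' -> parity T U = parity T' U.
Proof. by move=> H; apply: eq_bigr => v _; rewrite H. Qed.

(** The vertices that a path in [D] joins to [a] form a set that no edge of [D]
    leaves; its number of [T]-vertices is even, so [a] is not the only one.
    Paths are represented by edge sets with a two-point boundary. *)
Lemma path_join D T a :
  (forall U, crossing D U = set0 -> parity T U = false) -> T a ->
  exists b (P : {set E}), [/\ P \subset D, b != a, T b &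
    forall v, bd P v = (v == a) (+) (v == b)].
Proof.
move=> HT Ta.
pose U v := [exists P : {set E}, (P \subset D) &&
   [forall w, bd P w == (w == a) (+) (w == v)]].
have UP v : reflect (exists2 P : {set E}, P \subset D &
    forall w, bd P w = (w == a) (+) (w == v)) (U v).
  apply: (iffP existsP) => [[P /andP[PD /forallP H]]|[P PD H]]; exists P => //.
    by move=> w; apply/eqP.
  by rewrite PD; apply/forallP => w; rewrite H.
have step e x y : e \in D -> (forall w, bd [set e] w = (w == x) (+) (w == y)) ->
    U x -> U y.
  move=> eD He /UP[P PD H]; apply/UP; exists (symd P [set e]).
    by apply: symd_sub; rewrite // sub1set.
  by move=> w; rewrite bd_symd H He addbA addbK.
have U0 : crossing D U = set0.
  apply/setP => e; rewrite !inE; apply/negbTE; rewrite negb_and -implybE.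
  apply/implyP => eD; rewrite negb_add; apply/eqP; apply/idP/idP; apply: (step e) => // w.
    by rewrite bd_set1.
  by rewrite bd_set1 addbC.
have Ua : U a by apply/UP; exists set0; rewrite ?sub0set // => w; rewrite bd_set0 addbb.
have := HT U U0; rewrite /parity (bigD1 a) //= Ta /= => /negbFE.
move=> /xor_exists[b /andP[Ub ba] Tb]; have /UP[P PD H] := Ub.
by exists b, P.
Qed.

(** The [T]-vertices can be paired off by paths. *)
Lemma feasible_join D T :
  (forall U, crossing D U = set0 -> parity T U = false) ->
  exists2 J : {set E}, J \subset D & bd J =1 T.
Proof.
have [n] := ubnP #|T|; elim: n T => // n IH T; rewrite ltnS => Tn HT.
have [a Ta|T0] := pickP T; last first.
  by exists set0; [exact: sub0set|move=> v; rewrite bd_set0 T0].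
have [b [P [PD ba Tb HP]]] := path_join HT Ta.
pose T' v := T v (+) bd P v.
have [||J JD HJ] := IH T'.
- apply: leq_trans Tn; apply: proper_card; apply/properP; split.
    apply/subsetP => v; rewrite !unfold_in /T' HP.
    have [->|_] := eqVneq v a; first by rewrite Ta.
    by have [->|_] := eqVneq v b; rewrite ?Tb ?addbF.
  by exists a; rewrite !unfold_in // /T' HP Ta eqxx eq_sym (negbTE ba).
- move=> U U0; rewrite parity_addb HT // parity_bd_closed //.
  apply/setP => e; move/setP/(_ e): U0; rewrite !inE.
  by case: (boolP (e \in P)) => // /(subsetP PD) ->.
exists (symd J P); first exact: symd_sub.
by move=> v; rewrite bd_symd HJ /T' addbK.
Qed.

End Boundary.

(** * T-joins in bipartite graphs *)

(** Merging vertices along [q] replaces [T] by its parity on the fibres of [q];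
    cuts of the merged graph are the cuts that do not separate a fibre. *)
Lemma parity_push (V V' : finType) (q : V -> V') (T : pred V) (U : pred V') :
  parity (fun v => parity T (fun w => q w == v)) U = parity T (fun w => U (q w)).
Proof.
rewrite /parity [RHS](partition_big q U) //=; apply: eq_bigr => v Uv.
by apply: eq_bigl => w; case: eqP => [->|]; rewrite ?Uv ?andbF.
Qed.

Lemma bd_push (V V' E : finType) (s t : E -> V) (q : V -> V') (J : {set E}) v :
  bd (q \o s) (q \o t) J v = parity (bd s t J) (fun w => q w == v).
Proof. by rewrite parity_bd. Qed.

Lemma smallest_set (E : finType) (P : pred {set E}) J0 : P J0 ->
  exists2 J, P J & forall K, P K -> #|J| <= #|K|.
Proof.
move=> PJ0; case: (arg_minnP (fun J : {set E} => #|J|) PJ0) => J PJ Jmin.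
by exists J.
Qed.

Section Bipartite.
Variables (V E : finType).

(** Induction on the number of edges.  Among the edge sets whose boundary is
    [T] modified at a fixed [r] and at one further vertex, let [Js] be a
    smallest one and [z] the further vertex.  Then no smallest [T]-join has two
    edges at [z].  Contracting [z] with its neighbours then lowers the
    size of a smallest [T]-join by at most one; this uses that paths between
    neighbours of [z] have even length, the graph being bipartite.  The
    contraction removes the edges at [z], at least [g] of them since [z] is a
    [T]-vertex, while the odd cuts of the contracted graph are odd cuts of the
    original one. *)
Lemma tjoin_bipartite (g : nat) (s t : E -> V) (D : {set E}) (T : pred V)
    (c : V -> bool) :
  0 < g -> (forall U, parity T U -> g <= #|crossing s t D U|) ->
  (forall e, e \in D -> c (s e) != c (t e)) ->
  exists J : {set E}, [/\ J \subset D, bd s t J =1 T & g * #|J| <= #|D|].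
Proof.
move=> g0; have [n] := ubnP #|D|; elim: n s t D T c => // n IH s t D T c.
rewrite ltnS => Dn cut col.
have [r Tr|T0] := pickP T; last first.
  exists set0; split; rewrite ?sub0set ?cards0 ?muln0 // => v.
  by rewrite bd_set0 T0.
have [J0 J0D bdJ0] : exists2 J : {set E}, J \subset D & bd s t J =1 T.
  apply: feasible_join => U U0; apply/negP => /cut.
  by rewrite U0 cards0 leqNgt g0.
pose near_join (J : {set E}) v := (J \subset D) &&
  [forall w, bd s t J w == T w (+) ((w == r) (+) (w == v))].
have [|Js /existsP[z /andP[JsD /forallP bdJs]] Jsmin] :=
  @smallest_set _ (fun J => [exists v, near_join J v]) J0.
  apply/existsP; exists r; rewrite /near_join J0D; apply/forallP => w.
  by rewrite bdJ0 addbb addbF.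
(* Removing from [K] an edge at [z] moves the second modified vertex to the
   other end of that edge, against the choice of [Js]. *)
have avoid_z (K : {set E}) e : K \subset D ->
    (forall w, bd s t K w = T w (+) ((w == r) (+) (w == z))) ->
    #|K| <= #|Js| -> e \in K -> (s e != z) && (t e != z).
  move=> KD bdK KJs eK.
  have shorter y : (forall w, bd s t [set e] w = (w == z) (+) (w == y)) -> False.
    move=> He; have /Jsmin : [exists v, near_join (symd K [set e]) v].
      apply/existsP; exists y; apply/andP; split.
        by apply: symd_sub; rewrite // sub1set (subsetP KD).
      apply/forallP => w; rewrite bd_symd bdK He.
      by rewrite -!addbA addKb.
    by have := card_symd1_in eK; move: KJs; clear; lia.
  apply/andP; split; apply/eqP => ez.
    by apply: (shorter (t e)) => w; rewrite bd_set1 ez.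
  by apply: (shorter (s e)) => w; rewrite bd_set1 ez addbC.
have Js_avoid e : e \in Js -> (s e != z) && (t e != z).
  by apply: avoid_z => // w; apply/eqP.
have bdJsz : bd s t Js z = false by apply: bd_avoid => e /Js_avoid.
have zr : z != r.
  apply/eqP => zr; have := bdJs z; rewrite bdJsz zr eqxx /= addbF Tr.
  by [].
have Tz : T z.
  by have := bdJs z; rewrite bdJsz (negbTE zr) eqxx; case: (T z).
have [|J /andP[JD /forallP bdJ'] Jmin'] := @smallest_set _
  (fun J => (J \subset D) && [forall w, bd s t J w == T w]) J0.
  by rewrite J0D; apply/forallP => w; rewrite bdJ0.
have bdJ w : bd s t J w = T w by apply/eqP.
have Jmin (K : {set E}) : K \subset D -> (forall w, bd s t K w = T w) -> #|J| <= #|K|.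
  by move=> KD bdK; apply: Jmin'; rewrite KD; apply/forallP => w; rewrite bdK.
pose star := crossing s t D (pred1 z).
have starD : star \subset D by apply/subsetP => e; rewrite inE => /andP[].
have loopless e : e \in D -> s e != t e.
  by move=> /col; apply: contra_neq => ->.
have not_star e : e \in D -> e \notin star -> (s e != z) && (t e != z).
  move=> eD; rewrite inE eD /= -negb_or => /negP H; apply/negP => ez; apply: H.
  by have := loopless _ eD; case/orP: ez => /eqP ->; rewrite eqxx;
    [rewrite eq_sym|]; case: eqP.
have starN (C : {set E}) : C \subset D :\: star -> bd s t C z = false.
  move=> CD; apply: bd_avoid => x /(subsetP CD); rewrite inE => /andP[xS xD].
  exact: not_star.
have star_end e : e \in star -> exists2 v, v != z &
    forall w, bd s t [set e] w = (w == z) (+) (w == v).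
  rewrite inE => /andP[eD] /=; have := loopless _ eD; have [sz|sz] /= := eqVneq (s e) z.
    by rewrite sz => tz _; exists (t e); rewrite 1?eq_sym // => w; rewrite bd_set1 sz.
  by move=> _ /eqP tz; exists (s e) => // w; rewrite bd_set1 tz addbC.
have JsN e : e \in star -> e \notin Js.
  rewrite inE => /andP[_ H]; apply/negP => /Js_avoid /andP[/negbTE sz /negbTE tz].
  by move: H; rewrite /= sz tz.
(* A smallest T-join has only one edge at [z]: with two of them, part of its
   difference with [Js] could be exchanged and would bring an edge at [z]
   into a set as small as [Js]. *)
have unique (K : {set E}) e f : K \subset D -> (forall w, bd s t K w = T w) ->
    #|K| <= #|J| -> e \in K -> e \in star -> f \in K -> f \in star -> e = f.
  move=> KD bdK KJ eK eS fK fS; apply/eqP/negPn/negP => ef.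
  pose P := symd K Js.
  have PD : P \subset D by apply: symd_sub.
  have bdP w : bd s t P w = (w == r) (+) (w == z).
    by rewrite bd_symd bdK (eqP (bdJs w)) addKb.
  pose Q := P :\: star.
  have QE : Q = P :\: (P :&: star) by rewrite setDIr setDv set0U.
  have bdQ w : bd s t Q w = bd s t P w (+) bd s t (P :&: star) w by rewrite QE bd_diff ?subsetIl.
  have starh h b : h \in star -> b != z -> (b == s h) (+) (b == t h) ->
      forall w, bd s t [set h] w = (w == z) (+) (w == b).
    move=> /star_end[v vz Hv] bz; rewrite -bd_set1 Hv (negbTE bz) /= => /eqP bv.
    by rewrite bv.
  have Qz : bd s t Q z = false by apply: starN; apply: setSD.
  (* [A] with [h] is a path from [r] to [z] inside [P] whose only edge at [z]
     is its last one, [h]; the rest [R] of [P] is even. *)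
  have [h [A [hP hS AQ bdA]]] : exists h (A : {set E}),
      [/\ h \in P, h \in star, A \subset Q &
        forall w, bd s t A w (+) bd s t [set h] w = (w == r) (+) (w == z)].
    have [Qr|Qr] := boolP (bd s t Q r).
      have [b [A [AQ br Qb bdA]]] := path_join (@parity_bd_closed _ _ s t Q) Qr.
      have bz : b != z by apply: contraTneq Qb => ->; rewrite Qz.
      have := Qb; rewrite bdQ bdP (negbTE br) (negbTE bz) /=.
      move=> /bd_incident[h]; rewrite inE => /andP[hP hS] hb.
      exists h, A; split => // w.
      by rewrite bdA (starh h b) // -addbA (addbC (w == z)) addKb.
    have := Qr; rewrite bdQ bdP eqxx eq_sym (negbTE zr) /= negbK.
    move=> /bd_incident[h]; rewrite inE => /andP[hP hS] hb.
    exists h, set0; split; rewrite ?sub0set // => w.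
    have rz : r != z by rewrite eq_sym.
    by rewrite bd_set0 (starh h r hS rz hb) /= addbC.
  have hA : h \notin A by apply: contraTN hS => /(subsetP AQ); rewrite inE => /andP[].
  pose P1 := symd A [set h].
  have P1P : P1 \subset P.
    apply: symd_sub; last by rewrite sub1set.
    by apply: subset_trans AQ _; rewrite subsetDl.
  pose R := P :\: P1.
  have bdR w : bd s t R w = false by rewrite bd_diff // bdP bd_symd bdA addbb.
  have [x [xR xS xJs]] : exists x, [/\ x \in R, x \in star & x \notin Js].
    have inR y : y \in K -> y \in star -> y != h -> y \in R.
      move=> yK yS yh; rewrite !inE yK (negbTE (JsN _ yS)) (negbTE yh) addbF.
      rewrite andbT; apply: contraTN yS => /(subsetP AQ).
      by rewrite inE => /andP[].
    have [eh|eh] := eqVneq e h.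
      by exists f; rewrite inR ?JsN // -eh eq_sym.
    by exists e; rewrite inR ?JsN.
  have RP : R \subset P by apply: subsetDl.
  have RD : R \subset D by apply: subset_trans RP PD.
  have JK : #|J| <= #|symd K R|.
    by apply: Jmin => [|w]; [exact: symd_sub|rewrite bd_symd bdR addbF].
  have KR : #|symd Js R| <= #|Js|.
    have KPR : symd K (P :\: R) = symd Js R.
      apply/setP => y; rewrite !in_symd in_setD.
      have := subsetP RP y; rewrite /P in_symd.
      by case: (y \in K); case: (y \in Js); case: (y \in R) => //= /(_ isT).
    have := card_symd_split K RP; rewrite symdK KPR.
    by move: JK KJ; clear; lia.
  have := @avoid_z (symd Js R) x; rewrite in_symd xR (negbTE xJs) /=.
  case/(_ _ _ KR isT)/andP.
  - exact: symd_sub.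
  - by move=> w; rewrite bd_symd bdR addbF; apply/eqP.
  move: xS; rewrite inE => /andP[_] /= H /negbTE sz /negbTE tz.
  by move: H; rewrite sz tz.
have [e eJ eS] : exists2 e, e \in J & e \in star.
  have := Tz; rewrite -bdJ => /bd_incident[e eJ ez]; exists e => //.
  by rewrite inE (subsetP JD) // -[_ (+) _]/((s e == z) (+) (t e == z)) ![_ == z]eq_sym.
have onlye f : f \in J -> f \in star -> f = e.
  by move=> fJ fS; apply: (unique J).
pose N w := (w != z) && [exists f in star, (w == s f) || (w == t f)].
have N_end w : N w -> exists2 f, f \in star &
    forall x, bd s t [set f] x = (x == z) (+) (x == w).
  move=> /andP[wz /existsP[f /andP[fS wf]]]; exists f => //.
  have [v vz Hv] := star_end _ fS; suff -> : w = v by [].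
  have := Hv w; have := loopless f (subsetP starD _ fS).
  rewrite bd_set1 (negbTE wz) /=; case/orP: wf => /eqP ->; rewrite eqxx.
    by move=> /negbTE -> /esym/eqP.
  by rewrite eq_sym => /negbTE -> /esym/eqP.
have N_color w : N w -> c w = ~~ c z.
  move=> /andP[wz /existsP[f /andP[]]]; rewrite inE => /andP[/col cf /= fz].
  case/orP => /eqP ?; subst w; move: fz cf; rewrite (negbTE wz) ?addbF.
    by move=> /= /eqP ->; case: (c _); case: (c _).
  by move=> /eqP ->; case: (c _); case: (c _).
(* No set [C] that closes up once [z] is merged with its neighbours improves
   [J].  By decomposition it suffices to consider a path [P] between two
   neighbours [a] and [b]: a gain would be at least 2 by parity, so the edges
   from [z] to [a] and [b] could be added at no loss. *)
have contracted (C : {set E}) : C \subset D :\: star ->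
    (forall w, bd s t C w -> N w) -> #|J| <= #|symd J C|.
  have [k] := ubnP #|C|; elim: k C => // k IHk C; rewrite ltnS => Ck CD bdN.
  have [a Ca|C0] := pickP (bd s t C); last first.
    apply: Jmin => [|w]; last by rewrite bd_symd C0 addbF.
    by apply: symd_sub => //; apply: subset_trans CD _; apply: subsetDl.
  have [b [P [PC ba Cb bdP]]] := path_join (@parity_bd_closed _ _ s t C) Ca.
  have PD' : P \subset D :\: star by apply: subset_trans PC CD.
  have PD : P \subset D by apply: subset_trans PD' _; apply: subsetDl.
  have evenP : ~~ odd #|P|.
    have := parity_bd s t P c; rewrite (eq_parity _ bdP) parity_addb.
    rewrite /parity !xor_delta (N_color a) ?bdN // (N_color b) ?bdN // addbb.
    rewrite odd_card (eq_bigr (fun=> true)) => [<- //|x /(subsetP PD)/col].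
    by case: (c _); case: (c _).
  have starP x : x \in star -> x \notin P.
    by apply: contraTN => /(subsetP PD'); rewrite inE => /andP[].
  have JP : #|J| <= #|symd J P|.
    rewrite leqNgt; apply/negP => lt.
    have {}lt : #|symd J P| + 2 <= #|J|.
      have /(congr1 odd) := card_symd J P.
      rewrite !oddD odd_double (negbTE evenP) !addbF => Hodd.
      rewrite leqNgt; apply/negP => lt'; move: Hodd.
      have -> : #|J| = #|symd J P|.+1 by move: lt lt'; clear; lia.
      by rewrite /=; case: odd.
    have [fa faS Hfa] := N_end _ (bdN _ Ca).
    have [fb fbS Hfb] := N_end _ (bdN _ Cb).
    have eJP : e \in symd J P by rewrite in_symd eJ (negbTE (starP _ eS)).
    pose K := symd (symd J P) (symd [set fa] [set fb]).
    have KD : K \subset D.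
      by do 2 apply: symd_sub; rewrite ?sub1set ?(subsetP starD).
    have bdK w : bd s t K w = T w.
      rewrite !bd_symd bdJ bdP Hfa Hfb.
      by case: (T w); case: (w == a); case: (w == b); case: (w == z).
    have JK := Jmin K KD bdK.
    have fab : fa != fb.
      apply: contra_neq ba => fab; have := Hfb b; rewrite -fab Hfa eqxx.
      by case: (b == z) => //; case: eqP.
    have [ea|ea] := eqVneq e fa.
      have := card_symd1_in eJP; have := card_symd1_le (symd (symd J P) [set e]) fb.
      by move: JK lt; rewrite /K symdA ea; clear; lia.
    have [eb|eb] := eqVneq e fb.
      have := card_symd1_in eJP; have := card_symd1_le (symd (symd J P) [set e]) fa.
      by move: JK lt; rewrite /K [symd [set fa] _]symdC symdA eb; clear; lia.
    have KJ : #|K| <= #|J|.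
      apply: leq_trans lt; rewrite /K symdA.
      have := card_symd1_le (symd (symd J P) [set fa]) fb.
      by have := card_symd1_le (symd J P) fa; clear; lia.
    have faJ : fa \notin J.
      by apply: contra_neqN ea => /onlye -> //.
    have eK : e \in K.
      by rewrite !in_symd !in_set1 (negbTE ea) (negbTE eb) eJ (negbTE (starP _ eS)).
    have faK : fa \in K.
      by rewrite !in_symd !in_set1 eqxx (negbTE fab) (negbTE faJ) (negbTE (starP _ faS)).
    by move/eqP: ea; apply; apply: (unique K).
  have JCP : #|J| <= #|symd J (C :\: P)|.
    apply: IHk => [||w].
    - apply: leq_trans Ck; rewrite cardsD; have -> : C :&: P = P by apply/setIidPr.
      have : 0 < #|P|.
        rewrite card_gt0; apply: contra_neq ba => P0; have := bdP b.
        by rewrite P0 bd_set0 eqxx addbT; case: eqP.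
      by have := subset_leq_card PC; clear; lia.
    - by apply: subset_trans CD; apply: subsetDl.
    rewrite bd_diff // bdP; have [->|wa] := eqVneq w a; first by rewrite bdN.
    have [->|wb] := eqVneq w b; first by rewrite bdN.
    by rewrite !addbF => /bdN.
  by have := card_symd_split J PC; move: JP JCP; clear; lia.
pose q w := if N w then z else w.
(* The merged vertex keeps the name [z] but takes the colour of the
   neighbours of [z]. *)
pose c' v := if v == z then ~~ c z else c v.
have qz : q z = z by rewrite /q /N eqxx.
have qstar x : x \in star -> (q (s x) = z) /\ (q (t x) = z).
  move=> xS; have st y : (y == s x) || (y == t x) -> q y = z.
    have [->//|yz] := eqVneq y z; rewrite /q /N yz => H.
    by case: existsP => // -[]; exists x; rewrite xS.
  by split; apply: st; rewrite eqxx ?orbT.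
have c'q w : w != z -> c' (q w) = c w.
  rewrite /q /c'; case: (boolP (N w)) => [/N_color -> _|_ /negbTE -> //].
  by rewrite eqxx.
have [||e' |J' [J'D bdJ'' sizeJ']] := IH (q \o s) (q \o t) (D :\: star)
  (fun v => parity T (fun w => q w == v)) c'.
- apply: leq_trans Dn; apply: proper_card; apply/properP; split; first exact: subsetDl.
  by exists e; [apply: (subsetP starD)|rewrite inE eS].
- move=> U; rewrite parity_push => /cut /leq_trans; apply.
  apply: subset_leq_card; apply/subsetP => x; rewrite !in_set => /andP[xD Ux].
  rewrite xD /= andbT Ux andbT; apply: contraTN Ux => xS.
  by have [] := qstar x; rewrite ?inE ?xD //= => -> ->; rewrite addbb.
- rewrite inE => /andP[eS' e'D] /=; have /andP[sz tz] := not_star _ e'D eS'.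
  by rewrite !c'q ?col.
exists J; split => //.
pose C := symd J' (symd J [set e]).
have JeD : symd J [set e] \subset D :\: star.
  apply/subsetP => x; rewrite in_symd in_set1 inE => xJ.
  have xD : x \in D.
    have [->|xe] := eqVneq x e; first exact: (subsetP JD).
    by move: xJ; rewrite (negbTE xe) addbF; apply: (subsetP JD).
  rewrite xD andbT; apply: contraTN xJ => xS.
  have [->|xe] := eqVneq x e; first by rewrite eJ.
  by rewrite addbF; apply: contra_neqN xe => /onlye ->.
have CD : C \subset D :\: star by apply: symd_sub.
have bdC w : bd s t C w -> N w.
  apply: contraTT => Nw; have [->|wz] := eqVneq w z; first by rewrite starN.
  have fiber T1 : parity T1 (fun x => q x == w) = T1 w.
    rewrite -[RHS]parity1 /parity; apply: eq_bigl => x; rewrite /= /q.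
    case: (boolP (N x)) => // Nx; rewrite eq_sym (negbTE wz); symmetry.
    by apply: contraNF Nw => /eqP <-.
  rewrite !bd_symd bdJ -[X in X (+) _](fiber (bd s t J')) -bd_push bdJ'' fiber addKb.
  have [v vz Hv] := star_end _ eS; rewrite Hv (negbTE wz) /=.
  apply: contraNN Nw => /eqP ->; rewrite /N vz; apply/existsP; exists e.
  rewrite eS; have := Hv v; rewrite bd_set1 eqxx (negbTE vz) /=.
  by case: (v == s e).
have := contracted C CD bdC.
have -> : symd J C = symd J' [set e].
  by rewrite symdC -symdA [symd (symd J _) J]symdC symdK.
have starg : g <= #|star| by apply: cut; rewrite parity1.
have := card_symd1_le J' e; have := cardsID star D.
have -> : D :&: star = star by apply/setIidPr.
by move: starg sizeJ'; clear; nia.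
Qed.
End Bipartite.

(** * T-joins in general graphs *)

(** Subdividing every edge once makes the graph bipartite and doubles both the
    edge set and every join, while no cut gets smaller. *)
Lemma tjoin_unit (V E : finType) (g : nat) (s t : E -> V) (D : {set E}) (T : pred V) :
  0 < g -> (forall U, parity T U -> g <= #|crossing s t D U|) ->
  exists J : {set E}, [/\ J \subset D, bd s t J =1 T & g * #|J| <= #|D|].
Proof.
move=> g0 cut.
pose s' (x : E * bool) : V + E := inr x.1.
pose t' (x : E * bool) : V + E := inl (if x.2 then s x.1 else t x.1).
pose T' (v : V + E) := if v is inl v then T v else false.
have [U||J' [J'D bdJ' sizeJ']] := @tjoin_bipartite _ _ g s' t' (setX D [set: bool]) T'
  (fun v => if v is inl _ then true else false) g0.
- have -> : parity T' U = parity T (U \o inl).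
    rewrite /parity big_mkcond big_sumType /= [X in _ (+) X]big1 => [|e _]; last by case: U.
    by rewrite addbF -big_mkcond.
  move=> /cut /leq_trans; apply; pose half e := (e, U (inr e) (+) U (inl (s e))).
  have half_inj : injective half by move=> x y [].
  rewrite -(card_imset _ half_inj); apply: subset_leq_card.
  apply/subsetP => x /imsetP[e]; rewrite inE => /andP[eD /= Ue] ->.
  rewrite !inE eD /s' /t' /=.
  by move: Ue; case: (U (inr e)); case E1: (U (inl (s e))); case E2: (U (inl (t e)));
    rewrite //= ?E1 ?E2.
- by [].
pose J := [set e | (e, true) \in J'].
have both e : ((e, true) \in J') = ((e, false) \in J').
  have := bdJ' (inr e); rewrite /bd.
  rewrite (eq_bigr (fun x => (x == (e, true)) (+) (x == (e, false)))) => [|[f b] _].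
    by rewrite big_split /= !xor_delta; case: (_ \in _); case: (_ \in _).
  by rewrite /= addbF !xpair_eqE; case: b; rewrite ?andbT ?andbF ?addbF.
have J'E : J' = setX J [set: bool].
  by apply/setP => -[e []]; rewrite !inE andbT ?both.
exists J; split.
- apply/subsetP => e; rewrite inE => /(subsetP J'D).
  by rewrite inE => /andP[].
- move=> v; rewrite -[RHS]/(T' (inl v)) -bdJ' J'E /bd.
  rewrite [RHS](eq_bigl (fun x => (x.1 \in J) && true)); last by move=> x; rewrite !inE.
  rewrite -(pair_big (mem J) predT (fun e b => (s' (e, b) == inl v) (+) (t' (e, b) == inl v))) /=.
  by apply: eq_bigr => e _; rewrite big_bool.
- by move: sizeJ'; rewrite J'E !cardsX cardsT card_bool mulnA leq_pmul2r.
Qed.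

(** The edges of [Z] can be used at no cost: they are contracted, and a join
    of the contracted graph is corrected afterwards by edges of [Z]. *)
Theorem tjoin (V E : finType) (g : nat) (s t : E -> V) (D Z : {set E}) (T : pred V) :
  0 < g ->
  (forall U, parity T U -> crossing s t Z U = set0 -> g <= #|crossing s t D U|) ->
  exists J : {set E},
    [/\ J \subset D :|: Z, bd s t J =1 T & g * #|J :&: (D :\: Z)| <= #|D|].
Proof.
move=> g0; have [n] := ubnP #|Z|; elim: n s t Z T => // n IH s t Z T; rewrite ltnS => Zn cut.
have [Z0|[e eZ]] := set_0Vmem Z.
  subst Z; have [|J [JD bdJ sizeJ]] := @tjoin_unit _ _ g s t D T g0.
    move=> U TU; apply: cut => //; apply/setP => e; by rewrite !inE.
  exists J; split; rewrite ?setU0 ?setD0 //.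
  by rewrite (setIidPl _).
(* The edge [e] is contracted: its end [s e] is merged into [t e]. *)
pose q v := if v == s e then t e else v.
have [||J' [J'D bdJ' sizeJ']] := IH (q \o s) (q \o t) (Z :\ e)
    (fun v => parity T (fun w => q w == v)).
- by apply: leq_trans Zn; rewrite [#|Z|](cardsD1 e) eZ.
- move=> U; rewrite parity_push => TU Z0; apply: cut TU _.
  apply/setP => f; rewrite !inE; have [->|fe] := eqVneq f e.
    rewrite /= /q eqxx; case: eqP => [->|_]; by rewrite ?addbb ?andbF.
  by move/setP/(_ f): Z0; rewrite !inE fe.
have agree w : w != s e -> w != t e -> bd s t J' w = T w.
  move=> ws wt; have fiber T1 : parity T1 (fun x => q x == w) = T1 w.
    rewrite -[RHS]parity1 /parity; apply: eq_bigl => x; rewrite /= /q.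
    by case: (eqVneq x (s e)) => // ->; rewrite [t e == w]eq_sym [s e == w]eq_sym (negbTE ws) (negbTE wt).
  by rewrite -[LHS]fiber -bd_push bdJ' fiber.
have J'DZ : J' \subset D :|: Z.
  by apply: subset_trans J'D _; apply: setUS; apply: subD1set.
have sub J1 : J1 :&: (D :\: Z) \subset J' :&: (D :\: (Z :\ e)) -> g * #|J1 :&: (D :\: Z)| <= #|D|.
  move=> /subset_leq_card H; apply: leq_trans sizeJ'; by rewrite leq_mul2l H orbT.
have [st|st] := eqVneq (s e) (t e).
  exists J'; split => //.
    move=> w; have qid x : q x = x by rewrite /q; case: eqP => // ->.
    have := bdJ' w; rewrite bd_push /parity; under eq_bigl => x do rewrite qid.
    under [in RHS]eq_bigl => x do rewrite qid.
    by rewrite !big_pred1_eq.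
  by apply: sub; apply: setIS; apply: setDS; apply: subD1set.
have sumst : bd s t J' (s e) (+) bd s t J' (t e) = T (s e) (+) T (t e).
  have fiber T1 : parity T1 (fun x => q x == t e) = T1 (s e) (+) T1 (t e).
    rewrite /parity (bigD1 (s e)) /q ?eqxx //=; congr (_ (+) _).
    rewrite -[RHS]parity1 /parity; apply: eq_bigl => x.
    case: (eqVneq x (s e)) => [->|_]; rewrite ?andbF ?andbT //.
    by rewrite /= (negbTE st).
  by have := bdJ' (t e); rewrite bd_push !fiber.
pose J := if bd s t J' (s e) == T (s e) then J' else symd J' [set e].
exists J; rewrite /J; case: eqP => H; split => //.
- move=> w; have [->//|ws] := eqVneq w (s e).
  have [->|wt] := eqVneq w (t e); last exact: agree.
  by move: sumst; rewrite H => /addbI.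
- by apply: sub; apply: setIS; apply: setDS; apply: subD1set.
- by apply: symd_sub; rewrite ?sub1set ?inE ?eZ ?orbT.
- move=> w; rewrite bd_symd bd_set1; have [->|ws] := eqVneq w (s e).
    by rewrite (negbTE st); move: H; case: (bd _ _ _ _); case: (T _).
  have [->|wt] := eqVneq w (t e).
    by move: sumst H; case: (bd _ _ _ _); case: (T _); case: (bd _ _ _ _); case: (T _).
  by rewrite !addbF agree.
apply: sub; apply/subsetP => f; rewrite !inE => /andP[fJ /andP[fZ fD]].
have fe : f != e by apply: contraNneq fZ => ->.
by move: fJ; rewrite (negbTE fe) addbF fD (negbTE fZ) /= => ->.
Qed.

(** * Duality in the square grid *)

Section Grid.
Variable n : nat.

Definition gpoint := ('I_n.+2 * 'I_n.+2)%type.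
Definition gedge := (bool * 'I_n.+1 * 'I_n.+1)%type.
Implicit Types (e : gedge) (v : gpoint) (A : {set gedge}).

Definition pt (i j : nat) : gpoint := (inord i, inord j).
(** The edge leaving [(i, j)] to the right if [d] holds, upwards otherwise. *)
Definition ged (d : bool) (i j : nat) : gedge := (d, inord i, inord j).

Definition src e : gpoint := pt e.1.2 e.2.
Definition tgt e : gpoint := pt (e.1.1 + e.1.2) (~~ e.1.1 + e.2).
(** The squares on the two sides of an edge.  A square is named by its upper
    right corner, so that all the squares around the edges have names among the
    grid points. *)
Definition side1 e : gpoint := pt e.1.2.+1 e.2.+1.
Definition side2 e : gpoint := tgt e.

Lemma pt_eqE i j v : i < n.+2 -> j < n.+2 ->
  (pt i j == v) = (i == v.1) && (j == v.2).
Proof. by case: v => a b hi hj; rewrite /pt xpair_eqE -!val_eqE /= !inordK. Qed.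

Lemma ged_eqE d i j e : i < n.+1 -> j < n.+1 ->
  (e == ged d i j) = [&& e.1.1 == d, val e.1.2 == i & val e.2 == j].
Proof.
by move=> hi hj; case: e => [[d' a] b]; rewrite /ged !xpair_eqE -!val_eqE /= !inordK // -andbA.
Qed.

Lemma xor_delta4 A e1 e2 e3 e4 (F : gedge -> bool) :
  (forall e, F e = (e == e1) (+) (e == e2) (+) (e == e3) (+) (e == e4)) ->
  \xor_(e in A) F e = (e1 \in A) (+) (e2 \in A) (+) (e3 \in A) (+) (e4 \in A).
Proof.
by move=> H; under eq_bigr => e _ do rewrite H; rewrite !big_split /= !xor_delta.
Qed.

Lemma bd_vertex A i j : i < n -> j < n ->
  bd src tgt A (pt i.+1 j.+1) =
  (ged true i.+1 j.+1 \in A) (+) (ged true i j.+1 \in A) (+)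
  (ged false i.+1 j.+1 \in A) (+) (ged false i.+1 j \in A).
Proof.
move=> hi hj; apply: xor_delta4 => -[[d a] b].
rewrite !ged_eqE; try lia.
have := ltn_ord a; have := ltn_ord b.
rewrite /src /tgt /= => hb ha; rewrite !pt_eqE; try by case: d; lia.
by rewrite /= !inordK; lia.
Qed.

Lemma bd_cell A i j : i < n -> j < n ->
  bd side1 side2 A (pt i.+1 j.+1) =
  (ged true i j \in A) (+) (ged true i j.+1 \in A) (+)
  (ged false i j \in A) (+) (ged false i.+1 j \in A).
Proof.
move=> hi hj; apply: xor_delta4 => -[[d a] b].
rewrite !ged_eqE; try lia.
have := ltn_ord a; have := ltn_ord b.
rewrite /side1 /side2 /tgt /= => hb ha; rewrite !pt_eqE; try by case: d; lia.
by rewrite /= !inordK; lia.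
Qed.

(** The points all of whose four edges belong to the grid. *)
Definition inner v := [&& 0 < v.1, v.1 < n.+1, 0 < v.2 & v.2 < n.+1].

Lemma innerP v : inner v ->
  exists i j, [/\ i < n, j < n & v = pt i.+1 j.+1].
Proof.
case: v => a b /and4P[/= a0 an b0 bn]; exists a.-1, b.-1; split; try lia.
by rewrite !prednK // /pt !inord_val.
Qed.

Lemma side1_ged d i j : i < n.+1 -> j < n.+1 -> side1 (ged d i j) = pt i.+1 j.+1.
Proof. by move=> hi hj; rewrite /side1 /= !inordK. Qed.
Lemma src_ged d i j : i < n.+1 -> j < n.+1 -> src (ged d i j) = pt i j.
Proof. by move=> hi hj; rewrite /src /= !inordK. Qed.
Lemma tgt_ged d i j : i < n.+1 -> j < n.+1 -> tgt (ged d i j) = pt (d + i) (~~ d + j).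
Proof. by move=> hi hj; rewrite /tgt /= !inordK. Qed.

(** Going once around a vertex, one enters and leaves the set [u] of squares
    equally often. *)
Lemma dual_cut_even (u : pred gpoint) v : inner v ->
  bd src tgt (crossing side1 side2 [set: gedge] u) v = false.
Proof.
move=> /innerP[i [j [hi hj ->]]]; rewrite bd_vertex //.
rewrite !inE /= !side1_ged; try lia; rewrite /side2 !tgt_ged /=; try lia.
rewrite !add1n !add0n.
by case: (u _); case: (u _); case: (u _); case: (u _).
Qed.

(** The potential of a point is the parity of the edges of [A] on the route
    that first goes up along the first column and then right; comparing the
    routes to two vertically adjacent points crosses a row of squares, around
    each of which [A] is even. *)
Lemma grid_potential A : (forall v, bd side1 side2 A v = false) ->
  exists phi : pred gpoint, forall e, inner (src e) -> inner (tgt e) ->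
    (e \in A) = phi (src e) (+) phi (tgt e).
Proof.
move=> A0.
pose col j := \big[addb/false]_(0 <= k < j) (ged false 0 k \in A).
pose row i j := \big[addb/false]_(0 <= k < i) (ged true k j \in A).
pose phi v := col (val v.2) (+) row (val v.1) (val v.2).
have rowS i j : i < n.+1 -> j < n ->
  row i j.+1 = row i j (+) (ged false 0 j \in A) (+) (ged false i j \in A).
  move=> + hj; elim: i => [|i IH] hi; first by rewrite /row !big_nil /= addbb.
  rewrite /row !big_nat_recr //= -/(row _ _) -/(row _ _) IH; last lia.
  have := A0 (pt i.+1 j.+1); rewrite bd_cell //.
  by do 4 case: (ged _ _ _ \in A); case: (row _ _); case: (ged false 0 j \in A).
exists phi => -[[d a] b]; have -> : (d, a, b) = ged d a b by rewrite /ged !inord_val.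
rewrite src_ged // tgt_ged // /inner /=.
have ha := ltn_ord a; have hb := ltn_ord b.
rewrite !inordK; try by case: d; lia.
case: d; rewrite /= ?add0n ?add1n => s_int t_int; rewrite /phi /= !inordK; try lia.
  rewrite /row big_nat_recr //= -/(row _ _).
  by case: (col _); case: (row _ _); case: (ged _ _ _ \in A).
rewrite rowS; try lia.
rewrite /col big_nat_recr //= -/(col _).
by case: (col _); case: (row _ _); case: (ged _ _ _ \in A); case: (ged _ _ _ \in A).
Qed.

Definition gadj (u v : gpoint) : bool :=
  [exists e, ((src e == u) && (tgt e == v)) || ((src e == v) && (tgt e == u))].

Lemma gadj_ged (d : bool) i j : i < n.+1 -> j < n.+1 -> gadj (pt i j) (pt (d + i) (~~ d + j)).
Proof.
move=> hi hj; apply/existsP; exists (ged d i j).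
by rewrite src_ged // tgt_ged // !eqxx.
Qed.

Lemma gadj_sym : symmetric gadj.
Proof. by move=> u v; apply: eq_existsb => e; rewrite orbC. Qed.

End Grid.

(** * Even subgraphs and cuts *)

Section EvenSubgraphs.
Variable G : sgraph.
Implicit Types (f : {set G}) (C : {set {set G}}).

Lemma adj_neq (x y : G) : adj x y -> x != y.
Proof. by apply: contraTneq => ->; rewrite adj_irr. Qed.

Lemma edgesP f : reflect (exists x y : G, adj x y /\ f = [set x; y]) (f \in edges G).
Proof.
rewrite inE; apply: (iffP existsP) => [[x /existsP[y /andP[xy /eqP ->]]]|[x [y [xy ->]]]].
  by exists x, y.
by exists x; apply/existsP; exists y; rewrite xy eqxx.
Qed.

Lemma edge_pair (x y : G) : x != y -> [set x; y] \in edges G -> adj x y.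
Proof.
move=> xy /edgesP[a [b [ab /setP E]]].
have := E x; have := E y; rewrite !inE !eqxx orbT /=.
move=> /esym/orP[]/eqP yE /esym/orP[]/eqP xE; subst => //; rewrite ?eqxx // in xy.
by rewrite adj_sym.
Qed.

Lemma mem_pair (x y v : G) : x != y -> (v \in [set x; y]) = (v == x) (+) (v == y).
Proof.
move=> xy; rewrite !inE; have [->|//] := eqVneq v x.
by rewrite (negbTE xy).
Qed.

Lemma card_edge f : f \in edges G -> #|f| = 2.
Proof. by move=> /edgesP[x [y [/adj_neq xy ->]]]; rewrite cards2 xy. Qed.

Lemma edge_cut_mem (X : {set G}) f : f \in edges G ->
  (f \in edge_cut X) = \xor_(v in X) (v \in f).
Proof.
move=> fE; rewrite inE fE /=; have /edgesP[x [y [/adj_neq xy ->]]] := fE.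
under eq_bigr => v _ do rewrite mem_pair //.
rewrite big_split /= !xor_delta setIUl.
rewrite cardsU; have -> : [set x] :&: X :&: ([set y] :&: X) = set0.
  by apply/setP => v; rewrite !inE; case: eqP => //= ->; rewrite (negbTE xy) andbF.
rewrite cards0 subn0.
have card1 a : #|[set a] :&: X| = (a \in X).
  case: (boolP (a \in X)) => aX.
    by rewrite (setIidPl _) ?cards1 // sub1set.
  rewrite (_ : _ :&: _ = set0) ?cards0 //; apply/setP => v; rewrite !inE.
  by case: eqP => //= ->; apply/negbTE.
by rewrite !card1; case: (x \in X); case: (y \in X).
Qed.

Definition even_subgraph C := forall v : G, \xor_(f in C) (v \in f) = false.

(** Summing the degrees in [C] over the vertices of [X] counts the edges inside
    [X] twice. *)
Lemma even_subgraph_cut C (X : {set G}) : C \subset edges G -> even_subgraph C ->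
  \xor_(f in C) (f \in edge_cut X) = false.
Proof.
move=> CE evC; rewrite (eq_bigr (fun f => \xor_(v in X) (v \in f))).
  by rewrite exchange_big big1.
by move=> f /(subsetP CE) fE; rewrite edge_cut_mem.
Qed.

Lemma even_subgraph_bridgeless C f : C \subset edges G -> even_subgraph C ->
  f \in C -> f \notin bridges G.
Proof.
move=> CE evC fC; apply/negP; rewrite inE => /andP[_ /existsP[X /eqP cutX]].
have := even_subgraph_cut X CE evC; rewrite cutX.
by under eq_bigr => h _ do rewrite in_set1; rewrite xor_delta fC.
Qed.

Lemma path_pred (e : rel G) x p v : path e x p -> v \in p -> exists u, e u v.
Proof.
elim: p x => // y p IH x /= /andP[xy yp]; rewrite inE => /orP[/eqP ->|]; last exact: IH yp.
by exists x.
Qed.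

(** An edge [xy] of [C] lies on a cycle of [C]: the vertices that the rest of
    [C] joins to [x] would otherwise span a cut meeting [C] in [xy] alone.  All
    the vertices of this cycle have degree at least 2 in [C], so [C] has at
    least as many edges as the cycle has vertices. *)
Lemma even_subgraph_girth C g : girth_ge G g -> C \subset edges G ->
  even_subgraph C -> C != set0 -> g <= #|C|.
Proof.
move=> girthG CE evC /set0Pn[f fC].
have /edgesP[x [y [xy fE]]] := subsetP CE _ fC.
have nxy := adj_neq xy.
pose e u v := [&& u != v, [set u; v] \in C & [set u; v] != f].
have e_adj u v : e u v -> adj u v.
  by case/and3P => uv uvC _; apply: edge_pair => //; apply: (subsetP CE).
have e_sym : symmetric e by move=> u v; rewrite /e eq_sym (setUC [set u]).
have /connectP[p xp yp] : connect e x y.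
  pose U := [set v | connect e x v].
  have := even_subgraph_cut U CE evC; rewrite (bigD1 f) //= big1 => [|h /andP[hC hf]].
    rewrite edge_cut_mem ?(subsetP CE) // addbF fE.
    under eq_bigr => v _ do rewrite mem_pair //.
    by rewrite big_split /= !xor_delta !inE connect0; case: connect.
  rewrite edge_cut_mem ?(subsetP CE) //.
  have /edgesP[a [b [/adj_neq ab hE]]] := subsetP CE _ hC; rewrite hE.
  under eq_bigr => v _ do rewrite mem_pair //.
  rewrite big_split /= !xor_delta !inE.
  have eab : e a b by rewrite /e ab -hE hC hf.
  rewrite (same_connect_r _ (connect1 eab)) ?addbb //; exact: sym_connect_sym.
case/shortenP: xp yp => p' xp' up' _ yp'.
have size_c : 2 < size (x :: p').
  case: p' xp' up' yp' => [|a [|b p']] //= xp' _ ya; first by rewrite ya eqxx in nxy.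
  by move: xp'; rewrite -ya /e -fE eqxx !andbF.
have cyc : ucycle (@adj G) (x :: p').
  apply/andP; split=> //; rewrite /= rcons_path -yp' (sub_path e_adj) //=.
  by rewrite adj_sym.
apply: leq_trans (girthG _ cyc size_c) _.
have degE v : #|[set h in C | v \in h]| = \sum_(h in C) (v \in h).
  rewrite -sum1_card (eq_bigl (fun h => (h \in C) && (v \in h))) => [|h]; last by rewrite inE.
  by rewrite big_mkcondr; apply: eq_bigr => h _; case: (v \in h).
have deg2 v : v \in x :: p' -> 1 < #|[set h in C | v \in h]|.
  move=> vc; have [h hC vh] : exists2 h, h \in C & v \in h.
    move: vc; rewrite inE => /orP[/eqP ->|/(path_pred xp')[u /and3P[_ uvC _]]].
      by exists f; rewrite // fE !inE eqxx.
    by exists [set u; v]; rewrite // !inE eqxx orbT.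
  have pos : 0 < #|[set h in C | v \in h]| by apply/card_gt0P; exists h; rewrite inE hC.
  have : ~~ odd #|[set h in C | v \in h]|.
    rewrite degE (big_morph odd oddD (erefl : odd 0 = false)).
    by under eq_bigr => h' _ do rewrite oddb; rewrite evC.
  by move: pos; case: #|_| => [|[]].
rewrite -(card_uniqP up') -(leq_pmul2r (ltn0Sn 1)) -[#|C|]sum1_card big_distrl /=.
rewrite (eq_bigr (fun h : {set G} => \sum_(v in h) 1)) => [|h /(subsetP CE) hE]; last first.
  by rewrite sum1_card card_edge.
rewrite (eq_bigr (fun h : {set G} => \sum_v (v \in h : nat))) => [|h _]; last first.
  by rewrite big_mkcond; apply: eq_bigr => v _; case: (v \in h).
rewrite exchange_big /= -sum1_card big_distrl /= [X in X <= _]big_mkcond.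
by apply: leq_sum => v _; case: ifP => // /deg2; rewrite degE.
Qed.

End EvenSubgraphs.

(** * Switching in minors of the grid *)

Section GridMinor.
Variables (G : sgraph) (n : nat) (beta : gpoint n -> option G).

(** Here [beta u = Some v] means that [u] lies in the branch set of [v].
    Connectedness says that a function which is constant along the edges of a
    branch set is constant on it; an empty branch set is possible for an
    isolated vertex. *)
Record grid_minor : Prop := GridMinor {
  branch_interior : forall u v, beta u = Some v -> inner u;
  branch_connected : forall v (phi : pred (gpoint n)),
    (forall u w, gadj u w -> beta u = Some v -> beta w = Some v -> phi u = phi w) ->
    forall u w, beta u = Some v -> beta w = Some v -> phi u = phi w;
  branch_adj : forall x y : G, adj x y ->
    exists u w, [/\ gadj u w, beta u = Some x & beta w = Some y] }.

Definition links (e : gedge n) : bool :=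
  [exists x, exists y, [&& beta (src e) == Some x, beta (tgt e) == Some y & adj x y]].
Definition ends (e : gedge n) : {set G} :=
  [set v | (beta (src e) == Some v) || (beta (tgt e) == Some v)].
(** One grid edge for each edge of [G]: the links with the same ends form a
    class, and [pick] selects one link of each class. *)
Definition chosen : {set gedge n} :=
  [set e | links e && ([pick h | links h && (ends h == ends e)] == Some e)].
Definition inside (e : gedge n) : bool :=
  [exists v, (beta (src e) == Some v) && (beta (tgt e) == Some v)].

Lemma linksP e : links e -> exists x y,
  [/\ beta (src e) = Some x, beta (tgt e) = Some y, adj x y & ends e = [set x; y]].
Proof.
move=> /existsP[x /existsP[y /and3P[/eqP sx /eqP ty xy]]]; exists x, y; split => //.
apply/setP => v; rewrite !inE sx ty.
by rewrite ![Some _ == Some _](inj_eq Some_inj) ![_ == v]eq_sym.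
Qed.

Lemma chosen_links e : e \in chosen -> links e.
Proof. by rewrite inE => /andP[]. Qed.

Lemma chosen_inj : {in chosen &, injective ends}.
Proof.
move=> e h; rewrite !inE => /andP[_ /eqP pe] /andP[_ /eqP ph] eh.
by move: pe; rewrite eh ph => -[].
Qed.

Lemma chosen_edge e : e \in chosen -> ends e \in edges G.
Proof.
move=> /chosen_links/linksP[x [y [_ _ xy ->]]].
by apply/edgesP; exists x, y.
Qed.

Lemma chosen_not_inside e : e \in chosen -> ~~ inside e.
Proof.
move=> /chosen_links/linksP[x [y [sx ty xy _]]]; apply/existsP => -[v].
rewrite sx ty ![Some _ == Some _](inj_eq Some_inj) => /andP[/eqP xv /eqP yv].
by move: xy; rewrite xv yv adj_irr.
Qed.

Lemma chosen_ends e (v : G) : e \in chosen ->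
  (v \in ends e) = (beta (src e) == Some v) (+) (beta (tgt e) == Some v).
Proof.
move=> /chosen_links/linksP[x [y [sx ty xy ->]]]; rewrite sx ty.
by rewrite mem_pair ?adj_neq // ![Some _ == Some _](inj_eq Some_inj) ![_ == v]eq_sym.
Qed.

Hypothesis minor : grid_minor.

Lemma chosen_onto f : f \in edges G -> exists2 e, e \in chosen & ends e = f.
Proof.
move=> /edgesP[x [y [xy ->]]].
have [h lh hf] : exists2 h, links h & ends h = [set x; y].
  have [u [w [/existsP[h uw] ux wy]]] := branch_adj minor xy.
  have lh : links h.
    case/orP: uw => /andP[/eqP su /eqP tw]; apply/existsP.
      by exists x; apply/existsP; exists y; rewrite su tw ux wy !eqxx xy.
    by exists y; apply/existsP; exists x; rewrite su tw ux wy !eqxx adj_sym xy.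
  exists h => //; apply/setP => v; rewrite !inE.
  by case/orP: uw => /andP[/eqP -> /eqP ->]; rewrite ux wy;
    rewrite ![Some _ == Some _](inj_eq Some_inj) ![_ == v]eq_sym // orbC.
case E : [pick k | links k && (ends k == [set x; y])] => [e|]; last first.
  by move: E; case: pickP => // /(_ h); rewrite lh hf eqxx.
move: (E); case: pickP => // e' /andP[le' /eqP fe'] -[ee]; subst e'.
by exists e; rewrite // inE le' fe' E eqxx.
Qed.

Lemma card_ends (A : {set gedge n}) : A \subset chosen -> #|ends @: A| = #|A|.
Proof.
move=> /subsetP sA; apply: card_in_imset => e h /sA eC /sA hC; exact: chosen_inj.
Qed.

Lemma xor_ends (A : {set gedge n}) F : A \subset chosen ->
  \xor_(f in ends @: A) F f = \xor_(e in A) F (ends e).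
Proof.
move=> /subsetP sA; rewrite big_imset // => e h /sA eC /sA hC; exact: chosen_inj.
Qed.

(** Summing the degrees of the dual cut over the branch set of [v] leaves the
    edges of [G] at [v], because the edges inside a branch set count twice. *)
Lemma dual_cut_even_subgraph (U : pred (gpoint n)) :
  (forall e, U (side1 e) (+) U (side2 e) -> (e \in chosen) || inside e) ->
  even_subgraph (ends @: crossing (@side1 n) (@side2 n) chosen U).
Proof.
move=> HU v; rewrite xor_ends; last by apply/subsetP => e; rewrite inE => /andP[].
have := @parity_bd _ _ (@src n) (@tgt n)
  (crossing (@side1 n) (@side2 n) [set: _] U) (fun u => beta u == Some v).
rewrite {1}/parity big1 => [E|u /eqP uv]; last by apply: dual_cut_even; apply: branch_interior uv.
rewrite [RHS]E big_mkcond [RHS]big_mkcond; apply: eq_bigr => e _.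
rewrite !in_crossing in_setT /=; case: (boolP (U (side1 e) (+) U (side2 e))) => [/HU|]; last by rewrite andbF.
case: (boolP (e \in chosen)) => [eC _|_ /= /existsP[w /andP[/eqP -> /eqP ->]]].
  by rewrite -chosen_ends.
by rewrite addbb.
Qed.

(** The deleted edges [Z] are free for the join and the edges inside branch
    sets are forbidden.  The potential of the join together with the negative
    edges is then constant on branch sets, hence defines a set of vertices of
    [G] to switch at. *)
Lemma grid_minor_switching (g : nat) (S : {set {set G}}) :
  0 < g -> girth_ge G g -> S \subset edges G ->
  exists X, #|symdiff S (edge_cut X)| * g <= #|edges G| - #|bridges G|.
Proof.
move=> g0 girthG SE.
pose D := [set e in chosen | ends e \notin bridges G].
pose Z := [set e | (e \notin chosen) && ~~ inside e].
pose A := [set e in chosen | ends e \in S].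
have DC : D \subset chosen by apply/subsetP => e; rewrite inE => /andP[].
have AC : A \subset chosen by apply/subsetP => e; rewrite inE => /andP[].
have [U TU Z0|J [JDZ bdJ sizeJ]] := @tjoin _ _ g (@side1 n) (@side2 n) D Z (bd (@side1 n) (@side2 n) A) g0.
  have HU e : U (side1 e) (+) U (side2 e) -> (e \in chosen) || inside e.
    by move=> Ue; move/setP/(_ e): Z0; rewrite !inE Ue andbT -negb_or => /negbFE.
  have evC := dual_cut_even_subgraph HU.
  pose K := crossing (@side1 n) (@side2 n) chosen U.
  have KC : K \subset chosen by apply/subsetP => e; rewrite inE => /andP[].
  have CE : ends @: K \subset edges G.
    by apply/subsetP => f /imsetP[e /(subsetP KC)/chosen_edge eE ->].
  have -> : crossing (@side1 n) (@side2 n) D U = K.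
    apply/setP => e; rewrite inE [in RHS]inE [e \in D]inE.
    apply/andP/andP => [[/andP[-> _] ->//]|[eC Ue]]; split => //; rewrite eC /=.
    apply: (even_subgraph_bridgeless CE evC); apply: imset_f.
    by rewrite inE eC.
  rewrite -(card_ends KC); apply: even_subgraph_girth => //.
  move: TU; rewrite parity_bd => /xor_exists[e eA Ue].
  apply/set0Pn; exists (ends e); apply: imset_f.
  by rewrite inE (subsetP AC).
have bd0 v : bd (@side1 n) (@side2 n) (symd J A) v = false by rewrite bd_symd bdJ addbb.
have [phi Hphi] := grid_potential bd0.
have JD e : e \in chosen -> e \in J -> e \in D.
  by move=> eC /(subsetP JDZ); rewrite inE => /orP[//|]; rewrite inE eC.
have phi_inside e : inside e -> phi (src e) = phi (tgt e).
  move=> ine; have /existsP[v /andP[/eqP sv /eqP tv]] := ine.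
  have := Hphi e (branch_interior minor sv) (branch_interior minor tv).
  have eC : e \notin chosen by apply: contraL ine => /chosen_not_inside.
  have eA : e \notin A by apply: contraNN eC => /(subsetP AC).
  have eJ : e \notin J.
    apply/negP => /(subsetP JDZ); rewrite inE => /orP[/(subsetP DC)|].
      by rewrite (negbTE eC).
    by rewrite inE ine andbF.
  by rewrite in_symd (negbTE eA) (negbTE eJ) => /esym/negbT; rewrite negb_add => /eqP.
have phi_const v u w : beta u = Some v -> beta w = Some v -> phi u = phi w.
  apply: (branch_connected minor) => {}u {}w /existsP[e uw] uv wv.
  have ine : inside e.
    by apply/existsP; exists v; case/orP: uw => /andP[/eqP -> /eqP ->]; rewrite uv wv !eqxx.
  by have := phi_inside e ine; case/orP: uw => /andP[/eqP -> /eqP ->].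
pose X := [set v | [exists u, (beta u == Some v) && phi u]].
have XE u v : beta u = Some v -> (v \in X) = phi u.
  move=> uv; rewrite inE; apply/existsP/idP => [[w /andP[/eqP wv]]|pu].
    by rewrite (phi_const _ _ _ uv wv).
  by exists u; rewrite uv eqxx.
exists X.
have -> : symdiff S (edge_cut X) = ends @: (J :&: D).
  apply/setP => f; rewrite in_setU !in_setD.
  have [fE|fE] := boolP (f \in edges G); last first.
    have /negbTE fS : f \notin S by apply: contraNN fE => /(subsetP SE).
    have /negbTE fX : f \notin edge_cut X by rewrite inE (negbTE fE).
    rewrite fS fX /=; symmetry; apply: contraNF fE => /imsetP[e].
    by rewrite inE => /andP[_ /(subsetP DC)/chosen_edge eE] ->.
  have [e eC ef] := chosen_onto fE.
  have eA : (e \in A) = (f \in S) by rewrite inE eC ef.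
  have -> : (f \in ends @: (J :&: D)) = (e \in J).
    apply/imsetP/idP => [[h]|eJ].
      rewrite inE => /andP[hJ /(subsetP DC) hC] fh.
      by rewrite (chosen_inj eC hC) // ef.
    by exists e; rewrite // inE eJ (JD e).
  have [x [y [sx ty /adj_neq xy exy]]] := linksP (chosen_links eC).
  have -> : (f \in edge_cut X) = phi (src e) (+) phi (tgt e).
    rewrite edge_cut_mem // -ef exy; under eq_bigr => v _ do rewrite mem_pair //.
    by rewrite big_split /= !xor_delta (XE _ _ sx) (XE _ _ ty).
  rewrite -(Hphi e (branch_interior minor sx) (branch_interior minor ty)) in_symd eA.
  by case: (f \in S); case: (e \in J).
have JDC : J :&: D \subset chosen by apply: subset_trans (subsetIr _ _) DC.
rewrite card_ends // mulnC.
have -> : #|edges G| - #|bridges G| = #|D|.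
  have bE : bridges G \subset edges G by apply/subsetP => f; rewrite inE => /andP[].
  rewrite -(card_ends DC) -(setIidPr bE) -cardsD; apply: eq_card => f.
  apply/setDP/imsetP => [[fE fb]|[e]].
    by have [e eC ef] := chosen_onto fE; exists e; rewrite // inE eC ef.
  by rewrite inE => /andP[eC eb] ->; split => //; apply: chosen_edge.
have DZ : D :\: Z = D.
  apply/setDidPl; rewrite disjoint_sym disjoint_subset; apply/subsetP => e.
  by rewrite !inE => /andP[/negbTE -> _].
by rewrite -{1}DZ.
Qed.

End GridMinor.

(** * Connected sets of grid points along a sequence of squares *)

Section Trail.
Variable n : nat.

Definition grid_connected (Q : {set gpoint n}) : Prop :=
  forall phi : pred (gpoint n),
    (forall u w, u \in Q -> w \in Q -> gadj u w -> phi u = phi w) ->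
    forall u w, u \in Q -> w \in Q -> phi u = phi w.

(** The corners of the squares with lower left corners [(a k, c k)]. *)
Definition trail (N : nat) (a c : nat -> nat) : {set gpoint n} :=
  [set v | [exists k : 'I_N.+1, [exists b : bool, [exists d : bool,
     v == pt n (a k + b) (c k + d)]]]].

Lemma trailP N a c v :
  reflect (exists k (b d : bool), k <= N /\ v = pt n (a k + b) (c k + d)) (v \in trail N a c).
Proof.
rewrite inE; apply: (iffP existsP) => [[k /existsP[b /existsP[d /eqP ->]]]|[k [b [d [kN ->]]]]].
  by exists k, b, d; split => //; rewrite -ltnS.
exists (Ordinal (kN : k < N.+1)); apply/existsP; exists b.
by apply/existsP; exists d.
Qed.

Variables (N : nat) (a c : nat -> nat).
Hypothesis ac_bound : forall k, k <= N -> [/\ 0 < a k, a k < n, 0 < c k & c k < n].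

Lemma trail_interior v : v \in trail N a c -> inner v.
Proof.
move=> /trailP[k [b [d [/ac_bound[a0 an c0 cn] ->]]]].
by rewrite /inner /pt /= !inordK; case: b; case: d; lia.
Qed.

Lemma trail_connected :
  (forall k, k < N -> [/\ a k <= (a k.+1).+1, a k.+1 <= (a k).+1,
                          c k <= (c k.+1).+1 & c k.+1 <= (c k).+1]) ->
  grid_connected (trail N a c).
Proof.
move=> step phi Hphi.
have inQ k (b d : bool) : k <= N -> pt n (a k + b) (c k + d) \in trail N a c.
  by move=> kN; apply/trailP; exists k, b, d.
have corner k (b d : bool) : k <= N ->
    phi (pt n (a k + b) (c k + d)) = phi (pt n (a k) (c k)).
  move=> kN; have [_ an _ cn] := ac_bound kN.
  have right (d' : bool) : phi (pt n (a k + true) (c k + d')) = phi (pt n (a k + false) (c k + d')).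
    apply: Hphi; rewrite ?inQ // gadj_sym /= addn1 addn0.
    by apply: (@gadj_ged n true (a k) (c k + d')); case: d' => /=; lia.
  have up : phi (pt n (a k + false) (c k + true)) = phi (pt n (a k + false) (c k + false)).
    apply: Hphi; rewrite ?inQ // gadj_sym /= addn1 !addn0.
    by apply: (@gadj_ged n false (a k) (c k)); lia.
  by case: b; case: d; rewrite ?right ?up ?addn0.
have base k : k <= N -> phi (pt n (a k) (c k)) = phi (pt n (a 0) (c 0)).
  elim: k => // k IH kN; rewrite -IH; last exact: ltnW.
  have [a1 a2 c1 c2] := step k kN.
  (* Squares at distance at most 1 in both directions share a corner. *)
  have := corner k (a k < a k.+1) (c k < c k.+1) (ltnW kN).
  have := corner k.+1 (a k.+1 < a k) (c k.+1 < c k) kN.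
  have -> : a k.+1 + (a k.+1 < a k) = a k + (a k < a k.+1) by lia.
  have -> : c k.+1 + (c k.+1 < c k) = c k + (c k < c k.+1) by lia.
  by move=> -> ->.
move=> u w /trailP[k [b [d [kN ->]]]] /trailP[l [b' [d' [lN ->]]]].
by rewrite !corner // !base.
Qed.

End Trail.

(** * Branch sets from the thirds of the edges *)

Section Pieces.
Variables (G : sgraph) (E : finType) (hd tl : E -> G).

Definition piece_vertex (p : E * 'I_3) : option G :=
  match val p.2 with 0 => Some (hd p.1) | 1 => None | _ => Some (tl p.1) end.

Definition third (i : nat) (f : E) : E * 'I_3 := (f, inord i).

Lemma third0 f : piece_vertex (third 0 f) = Some (hd f).
Proof. by rewrite /piece_vertex /= inordK. Qed.

Lemma third2 f : piece_vertex (third 2 f) = Some (tl f).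
Proof. by rewrite /piece_vertex /= inordK. Qed.

(** For the thirds of the arcs of a drawing, these are the pairs that share a
    point. *)
Definition may_meet (p q : E * 'I_3) : Prop :=
  (p.1 = q.1 /\ p.2 <= q.2.+1 /\ q.2 <= p.2.+1) \/
  exists2 v, piece_vertex p = Some v & piece_vertex q = Some v.

Variables (n : nat) (Q : E * 'I_3 -> {set gpoint n}).
Hypothesis hd_tl : forall f, hd f != tl f.
Hypothesis ends_adj : forall x y : G, adj x y ->
  exists f, (hd f = x /\ tl f = y) \/ (hd f = y /\ tl f = x).
Hypothesis Q_interior : forall p u, u \in Q p -> inner u.
Hypothesis Q_connected : forall p, grid_connected (Q p).
Hypothesis Q_meet : forall p q u, u \in Q p -> u \in Q q -> may_meet p q.
Hypothesis Q_vertex : forall p q v, piece_vertex p = Some v -> piece_vertex q = Some v ->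
  exists2 u, u \in Q p & u \in Q q.
Hypothesis Q_edge : forall f i, i < 2 ->
  exists2 u, u \in Q (third i f) & u \in Q (third i.+1 f).

Let B (v : G) : {set gpoint n} :=
  [set u | [exists p, (piece_vertex p == Some v) && (u \in Q p)]].

Let BP v u : reflect (exists2 p, piece_vertex p = Some v & u \in Q p) (u \in B v).
Proof.
rewrite inE; apply: (iffP existsP) => [[p /andP[/eqP pv up]]|[p pv up]]; exists p => //.
by rewrite pv eqxx.
Qed.

Let B_disjoint u v w : u \in B v -> u \in B w -> v = w.
Proof.
move=> /BP[[f i] pv up] /BP[[f' j] qw uq].
have [[/= ff ij]|[x]] := Q_meet up uq; last by rewrite pv qw => -[->] [->].
move: pv qw; rewrite /piece_vertex /= -ff.
by case: i ij {up} => -[|[|[|i]]] //= hi; case: j {uq} => -[|[|[|j]]] //= hj;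
  first [by move=> _ [<-] [<-] | by case].
Qed.

Let middle f := Q (third 1 f).

Let middle_inj u f f' : u \in middle f -> u \in middle f' -> f = f'.
Proof.
move=> uf uf'; have [[]//|[v]] := Q_meet uf uf'.
by rewrite /piece_vertex /= inordK.
Qed.

Let middle_B u f v : u \in middle f -> u \in B v -> v = hd f \/ v = tl f.
Proof.
move=> uf /BP[[f' j] qv uq]; have [[/= ff _]|[w]] := Q_meet uf uq; last first.
  by rewrite /piece_vertex /= inordK.
move: qv; rewrite /piece_vertex /= -ff.
by case: j {uq} => -[|[|j]] //= _ [<-]; [left|right].
Qed.

(** The branch set of [hd f] extends along the middle third of [f] until this
    third first reaches the outer thirds at [tl f]. *)
Let step f u w := [&& gadj u w, u \in middle f :\: B (tl f) & w \in middle f :\: B (tl f)].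

Let gate_ex : exists a : E -> gpoint n, forall f, a f \in Q (third 0 f) /\ a f \in middle f.
Proof.
have [a Ha] := @fin_all_exists _ _ (fun f u => u \in Q (third 0 f) /\ u \in middle f)
  (fun f => let: ex_intro2 u h1 h2 := Q_edge f (isT : 0 < 2) in ex_intro _ u (conj h1 h2)).
by exists a.
Qed.

(** Each branch set consists of the outer thirds at its vertex and, for the
    edges [f] that leave it, of the part [Rch f] of the middle third that can
    be reached without entering the outer thirds at [tl f].  As the middle
    third is connected, it has an edge from [Rch f] to those thirds. *)
Lemma grid_minor_of_pieces : exists beta : gpoint n -> option G, grid_minor beta.
Proof.
have [a Ha] := gate_ex.
have aB f : a f \in B (hd f).
  by apply/BP; exists (third 0 f); rewrite ?third0 //; have [] := Ha f.
have aM f : a f \in middle f :\: B (tl f).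
  rewrite inE; have [_ ->] := Ha f; rewrite andbT; apply/negP => /(B_disjoint (aB f)) E1.
  by move: (hd_tl f); rewrite E1 eqxx.
pose Rch f := [set u | connect (step f) (a f) u].
have RchM f u : u \in Rch f -> u \in middle f :\: B (tl f).
  rewrite inE => /connectP[p]; elim/last_ind: p => [|p w IH]; first by move=> _ ->; apply: aM.
  by rewrite last_rcons rcons_path => /andP[_ /and3P[_ _ wM]] ->.
pose branch v := B v :|: [set u | [exists f, (hd f == v) && (u \in Rch f)]].
have branchP v u : reflect (u \in B v \/ exists2 f, hd f = v & u \in Rch f) (u \in branch v).
  rewrite in_setU [X in _ || X]inE; apply: (iffP orP) => -[|H]; try by left.
    by right; have /existsP[f /andP[/eqP fv uf]] := H; exists f.
  by right; have [f fv uf] := H; apply/existsP; exists f; rewrite fv eqxx.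
have RB f u v : u \in Rch f -> u \in B v -> v = hd f.
  move=> /RchM; rewrite inE => /andP[uB um] uv.
  have [//|vt] := middle_B um uv; by rewrite -vt uv in uB.
have branch_disjoint u v w : u \in branch v -> u \in branch w -> v = w.
  move=> /branchP[uv|[f <- uf]] /branchP[uw|[f' <- uf']].
  - exact: B_disjoint uv uw.
  - exact: RB uf' uv.
  - by rewrite (RB _ _ _ uf uw).
  - have /setDP[um _] := RchM _ _ uf; have /setDP[um' _] := RchM _ _ uf'.
    by rewrite (middle_inj um um').
pose beta u := [pick v | u \in branch v].
have betaP u v : beta u = Some v <-> u \in branch v.
  rewrite /beta; split; first by case: pickP => // w uw [<-].
  by case: pickP => [w uw uv|/(_ v) -> //]; rewrite (branch_disjoint _ _ _ uw uv).
have BrB v u : u \in B v -> u \in branch v by move=> uv; apply/branchP; left.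
have BrR f u : u \in Rch f -> u \in branch (hd f).
  by move=> uf; apply/branchP; right; exists f.
exists beta; split.
- by move=> u v /betaP/branchP[/BP[p _ up]|[f _ /RchM/setDP[up _]]]; apply: Q_interior up.
- move=> v phi Hphi.
  have {}Hphi u w : gadj u w -> u \in branch v -> w \in branch v -> phi u = phi w.
    by move=> uw /betaP ub /betaP wb; apply: Hphi.
  have Bconst u w : u \in B v -> w \in B v -> phi u = phi w.
    move=> /BP[p pv up] /BP[q qv wq]; have [z zp zq] := Q_vertex pv qv.
    have const r : piece_vertex r = Some v -> forall x y, x \in Q r -> y \in Q r -> phi x = phi y.
      move=> rv; apply: Q_connected => x y xr yr xy; apply: Hphi => //.
        by apply: BrB; apply/BP; exists r.
      by apply: BrB; apply/BP; exists r.
    by rewrite (const p pv u z) // (const q qv z w).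
  have toB u : u \in branch v -> exists2 w, w \in B v & phi u = phi w.
    case/branchP => [uv|[f fv uf]]; first by exists u.
    exists (a f); first by rewrite -fv.
    have := uf; rewrite inE => /connectP[p]; elim/last_ind: p u {uf} => [|p w IH] u; first by move=> _ ->.
    rewrite last_rcons rcons_path => /andP[ap st] ->; rewrite -(IH _ ap erefl).
    have pR : last (a f) p \in Rch f by rewrite inE; apply/connectP; exists p.
    have wR : w \in Rch f.
      by move: (pR); rewrite !inE => H; apply: connect_trans H _; apply: connect1.
    symmetry; apply: Hphi; first by case/and3P: st.
      by rewrite -fv BrR.
    by rewrite -fv BrR.
  move=> u w /betaP/toB[u' u'B ->] /betaP/toB[w' w'B ->]; exact: Bconst.
have cross f : exists u w, [/\ gadj u w, beta u = Some (hd f) & beta w = Some (tl f)].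
  have [/existsP[u /existsP[w /and3P[uw uR wB]]]|N] :=
    boolP [exists u, exists w, [&& gadj u w, u \in Rch f & w \in B (tl f)]].
    by exists u, w; split => //; apply/betaP; [apply: BrR|apply: BrB].
  have closed u w : u \in Rch f -> w \in middle f -> gadj u w -> w \in Rch f.
    move=> uR wm uw; have wB : w \notin B (tl f).
      apply: contraNN N => wB; apply/existsP; exists u; apply/existsP; exists w.
      by rewrite uw uR.
    move: (uR); rewrite !inE => H; apply: connect_trans H _; apply: connect1.
    by rewrite /step uw RchM // inE wB.
  have [b b1 b2] := Q_edge f (isT : 1 < 2).
  have : (a f \in Rch f) = (b \in Rch f).
    apply: (Q_connected (p := third 1 f) (phi := fun u => u \in Rch f)) => //.
      move=> u w um wm uw; apply/idP/idP => H; first exact: closed H wm uw.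
      by apply: closed H um _; rewrite gadj_sym.
    by have [] := Ha f.
  rewrite inE connect0 => /esym/RchM; rewrite inE => /andP[/negP bB _]; case: bB.
  by apply/BP; exists (third 2 f); rewrite ?third2.
move=> x y /ends_adj[f [[<- <-]|[<- <-]]]; first exact: cross.
by have [u [w [uw uh wt]]] := cross f; exists w, u; rewrite gadj_sym.
Qed.

End Pieces.

(** * Distances between disjoint curves *)

From mathcomp Require Import all_order all_algebra.
From mathcomp Require Import all_classical all_reals all_analysis.
From mathcomp Require Import ring lra.

Import Order.TTheory GRing.Theory Num.Theory.
Import numFieldNormedType.Exports.
Local Open Scope classical_set_scope.
Local Open Scope ring_scope.

Section Curves.
Variable R : realType.
Implicit Types (gam del : R -> R * R).

Lemma curve_near gam (s : R) (e : R) : {within `[0, 1], continuous gam} ->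
  s \in `[0, 1] -> 0 < e ->
  \forall s' \near s, s' \in `[0, 1] -> `|gam s - gam s'| < e.
Proof.
move=> /subspace_continuousP cg s01 e0.
by have /cvgrPdist_lt/(_ e e0) := cg s s01.
Qed.

(** Uniform continuity, by compactness of the parameter interval. *)
Lemma curve_uniform gam (e : R) : {within `[0, 1], continuous gam} -> 0 < e ->
  \forall d \near 0^'+, forall s t : R, s \in `[0, 1] -> t \in `[0, 1] ->
    `|s - t| <= d -> `|gam s - gam t| < e.
Proof.
move=> cg e0.
have := @segment_compact R 0 1; rewrite compact_near_coveringP => cov.
suff : \forall d \near 0^'+, `[0, 1]%classic `<=` (fun s => s \in `[0, 1] -> forall t : R, t \in `[0, 1] ->
  `|s - t| <= d -> `|gam s - gam t| < e).
  by apply: filterS => d Hd s t s01 t01; apply: Hd.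
apply: cov => s0 s001.
have e2 : 0 < e / 2 by rewrite divr_gt0.
have /nbhs_ballP[r /= r0 Hr] := curve_near cg s001 e2.
have r2 : 0 < r / 2 by rewrite divr_gt0.
near=> s d => /= s01 t t01 st.
have ss0 : `|s0 - s| < r / 2.
  by near: s; apply: (@cvgr_dist_lt _ _ _ _ _ id).
have dr : d < r / 2 by near: d; apply: nbhs_right_lt.
have Hs : `|gam s0 - gam s| < e / 2.
  by apply: Hr => //; rewrite /ball /=; lra.
have Ht : `|gam s0 - gam t| < e / 2.
  apply: Hr => //; rewrite /ball /=.
  have := ler_distD s s0 t; lra.
by rewrite (le_lt_trans (ler_distD (gam s0) _ _)) // [e]splitr (distrC (gam s)) ltrD.
Unshelve. all: end_near. Qed.

Lemma curve_point_separated gam (p : R * R) : {within `[0, 1], continuous gam} ->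
  (forall t, t \in `[0, 1] -> p <> gam t) ->
  \forall e \near 0^'+, forall t : R, t \in `[0, 1] -> e < `|p - gam t|.
Proof.
move=> cg pg.
have := @segment_compact R 0 1; rewrite compact_near_coveringP => cov.
suff : \forall e \near 0^'+, `[0, 1]%classic `<=` (fun t => t \in `[0, 1] -> e < `|p - gam t|).
  by apply: filterS => e He t t01; apply: He.
apply: cov => t0 t001.
have d0 : 0 < `|p - gam t0| by rewrite normr_gt0 subr_eq0; apply/eqP; apply: pg.
have d2 : 0 < `|p - gam t0| / 2 by rewrite divr_gt0.
near=> t e => /= t01.
have gt : `|gam t0 - gam t| < `|p - gam t0| / 2.
  by move: t01; near: t; apply: curve_near.
have er : e < `|p - gam t0| / 2 by near: e; apply: nbhs_right_lt.
have := ler_distD (gam t) p (gam t0); rewrite (distrC (gam t) (gam t0)) => H.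
rewrite -(ltrD2r `|gam t0 - gam t|) (lt_le_trans _ H) //.
by rewrite [ltRHS]splitr ltrD.
Unshelve. all: end_near. Qed.

(** Disjoint compact curves are a positive distance apart: compactness is
    applied to one parameter after the other. *)
Lemma curves_separated gam del : {within `[0, 1], continuous gam} ->
  {within `[0, 1], continuous del} ->
  (forall s t, s \in `[0, 1] -> t \in `[0, 1] -> gam s <> del t) ->
  \forall e \near 0^'+, forall s t : R, s \in `[0, 1] -> t \in `[0, 1] ->
    e < `|gam s - del t|.
Proof.
move=> cg cd gd.
have := @segment_compact R 0 1; rewrite compact_near_coveringP => cov.
suff : \forall e \near 0^'+, `[0, 1]%classic `<=`
    (fun s => s \in `[0, 1] -> forall t, t \in `[0, 1] -> e < `|gam s - del t|).
  by apply: filterS => e He s t s01; apply: He.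
apply: cov => s0 s001.
have [e0 [e00 He0]] : exists e0, 0 < e0 /\ forall t, t \in `[0, 1] -> e0 < `|gam s0 - del t|.
  apply: (@filter_ex _ (0^'+ : set_system R)); apply: filterI; first exact: nbhs_right_gt.
  by apply: curve_point_separated => // t t01; apply: gd.
have e2 : 0 < e0 / 2 by rewrite divr_gt0.
near=> s e => /= s01 t t01.
have gs : `|gam s0 - gam s| < e0 / 2.
  by move: s01; near: s; apply: curve_near.
have er : e < e0 / 2 by near: e; apply: nbhs_right_lt.
have H := lt_le_trans (He0 t t01) (ler_distD (gam s) (gam s0) (del t)).
by rewrite -(ltrD2l `|gam s0 - gam s|) (lt_trans _ H) // [ltRHS]splitr ltrD.
Unshelve. all: end_near. Qed.

End Curves.

(** * Digitization of curves *)

Section Digitization.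
Variable R : realType.

Lemma truncn_bounds (x : R) : 0 <= x ->
  (Num.truncn x)%:R <= x < (Num.truncn x)%:R + 1.
Proof. by move=> x0; rewrite natr1; apply: truncn_itv. Qed.

Lemma truncn_close (x y : R) : 0 <= x -> 0 <= y -> `|x - y| < 1 ->
  (Num.truncn x <= (Num.truncn y).+1)%N.
Proof.
move=> x0 y0 xy; rewrite truncn_le_nat -!natr1.
have /andP[_ yb] := truncn_bounds y0; move: xy; rewrite ltr_norml => /andP[_ xy]; lra.
Qed.

Lemma truncn_corner (x y : R) (b d : bool) : 0 <= x -> 0 <= y ->
  (Num.truncn x + b = Num.truncn y + d)%N -> `|x - y| <= 2.
Proof.
move=> x0 y0 /(congr1 (fun k => k%:R : R)); rewrite !natrD => H.
have /andP[xl xu] := truncn_bounds x0; have /andP[yl yu] := truncn_bounds y0.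
by rewrite ler_norml; apply/andP; move: H; case: b; case: d => /= H; split; lra.
Qed.

Lemma corner_lt m n (b : bool) : (m < n)%N -> (m + b < n.+2)%N.
Proof. by case: b; lia. Qed.

Lemma pt_inj n i j i' j' : (i < n.+2)%N -> (j < n.+2)%N -> (i' < n.+2)%N -> (j' < n.+2)%N ->
  pt n i j = pt n i' j' -> i = i' /\ j = j'.
Proof.
move=> hi hj hi' hj' [/(congr1 val) + /(congr1 val)]; by rewrite /= !inordK.
Qed.

(** The curves are sampled at the multiples of [1 / N], and [Q i] consists of
    the corners of the grid squares that contain the samples of [gam i].  With
    squares of side [h], consecutive samples less than [h] apart lie in squares
    sharing a corner, and squares sharing a corner contain only points at
    distance at most [2 * h]. *)
Theorem digitization (I : finType) (gam : I -> R -> R * R) :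
  (forall i, {within `[0, 1], continuous (gam i)}) ->
  exists n (Q : I -> {set gpoint n}),
    [/\ forall i v, v \in Q i -> inner v,
        forall i, grid_connected (Q i),
        forall i j, (forall s t, s \in `[0, 1] -> t \in `[0, 1] -> gam i s <> gam j t) ->
          forall v, v \in Q i -> v \in Q j -> False &
        forall i j (a b : bool), gam i a%:R = gam j b%:R ->
          exists2 v, v \in Q i & v \in Q j].
Proof.
move=> cont.
have [e [e0 sep]] : exists e : R, 0 < e /\ forall i j,
    (forall s t, s \in `[0, 1] -> t \in `[0, 1] -> gam i s <> gam j t) ->
    forall s t, s \in `[0, 1] -> t \in `[0, 1] -> e < `|gam i s - gam j t|.
  apply: (@filter_ex _ (0^'+ : set_system R)); apply: filterI; first exact: nbhs_right_gt.
  pose P i j (e : R) := (forall s t, s \in `[0, 1] -> t \in `[0, 1] -> gam i s <> gam j t) ->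
    forall s t, s \in `[0, 1] -> t \in `[0, 1] -> e < `|gam i s - gam j t|.
  apply: (@filter_forall _ _ (fun i e => forall j, P i j e) (0^'+) _) => i.
  apply: (@filter_forall _ _ (P i) (0^'+) _) => j; rewrite /P.
  have [D|ND] := pselect (forall s t, s \in `[0, 1] -> t \in `[0, 1] -> gam i s <> gam j t).
    by apply: filterS (curves_separated (cont i) (cont j) D) => e He _; apply: He.
  by apply: filterE => e /ND [].
pose h := e / 2.
have h0 : 0 < h by rewrite divr_gt0.
have [d [d0 unif]] : exists d : R, 0 < d /\ forall i s t, s \in `[0, 1] -> t \in `[0, 1] ->
    `|s - t| <= d -> `|gam i s - gam i t| < h.
  apply: (@filter_ex _ (0^'+ : set_system R)); apply: filterI; first exact: nbhs_right_gt.
  apply: (@filter_forall _ _ (fun i d => forall s t, s \in `[0, 1] -> t \in `[0, 1] ->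
    `|s - t| <= d -> `|gam i s - gam i t| < h) (0^'+) _) => i.
  exact: curve_uniform.
pose N := (Num.truncn d^-1).+1.
have N0 : (0 : R) < N%:R by rewrite ltr0n.
have Nd : N%:R^-1 < d.
  rewrite invf_plt ?posrE //; have : 0 <= d^-1 by rewrite invr_ge0 ltW.
  by move=> /truncn_bounds/andP[_]; rewrite natr1.
pose smp k : R := k%:R / N%:R.
have smp01 k : (k <= N)%N -> smp k \in `[0, 1].
  move=> kN; rewrite in_itv /= divr_ge0 ?ler0n //= ler_pdivrMr // mul1r.
  by rewrite ler_nat.
(* A bound for the samples; adding it makes all coordinates nonnegative. *)
pose L : R := \sum_i \sum_(k < N.+1) `|gam i (smp k)|.
have gamL i k : (k <= N)%N -> `|gam i (smp k)| <= L.
  move=> kN; rewrite /L (bigD1 i) //= (bigD1 (Ordinal (kN : (k < N.+1)%N))) //=.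
  by rewrite -addrA lerDl addr_ge0 ?sumr_ge0 // => ? _; rewrite sumr_ge0.
have coordL (p : R * R) : `|p| <= L -> (`|p.1| <= L) /\ (`|p.2| <= L).
  by rewrite prod_normE ge_max => /andP[].
pose scale (x : R) := (x + L) / h.
have scale0 x : `|x| <= L -> 0 <= scale x.
  by move=> xL; apply: divr_ge0; [move: xL; rewrite ler_norml => /andP[]; lra|exact: ltW].
have scaleB x y : scale x - scale y = (x - y) / h by rewrite /scale; field; lra.
pose n := (Num.truncn (scale L)).+2.
(* The shift by one keeps the corners away from the border of the grid. *)
pose idx x := (Num.truncn (scale x)).+1.
have idx_bound x : `|x| <= L -> (0 < idx x)%N /\ (idx x < n)%N.
  move=> xL; split => //; rewrite ltnS ltnS; apply: le_truncn.
  by rewrite ler_pM2r ?invr_gt0 // lerD2r; move: xL; rewrite ler_norml => /andP[].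
pose ax i k := idx (gam i (smp k)).1.
pose ay i k := idx (gam i (smp k)).2.
have bnd i k : (k <= N)%N -> [/\ (0 < ax i k)%N, (ax i k < n)%N, (0 < ay i k)%N & (ay i k < n)%N].
  move=> /(gamL i)/coordL[/idx_bound[? ?] /idx_bound[? ?]]; by split.
have idx_close x y : `|x| <= L -> `|y| <= L -> `|x - y| < h -> (idx x <= (idx y).+1)%N.
  move=> xL yL xy; rewrite ltnS; apply: truncn_close; rewrite ?scale0 //.
  by rewrite scaleB normrM (gtr0_norm (_ : 0 < h^-1)) ?invr_gt0 // ltr_pdivrMr // mul1r.
exists n, (fun i => trail n N (ax i) (ay i)); split.
- by move=> i v; apply: trail_interior => k; apply: bnd.
- move=> i; apply: trail_connected => [k|k kN]; first exact: bnd.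
  have [x1 y1] := coordL _ (gamL i k (ltnW kN)).
  have [x2 y2] := coordL _ (gamL i k.+1 kN).
  have : `|gam i (smp k) - gam i (smp k.+1)| < h.
    apply: unif; rewrite ?smp01 // 1?ltnW // /smp -mulrBl -natr1.
    rewrite opprD addNKr normrM normrN normr1 mul1r ger0_norm ?invr_ge0 ?ler0n //.
    exact: ltW.
  rewrite prod_normE gt_max /= => /andP[hx hy].
  by split; apply: idx_close => //; rewrite distrC.
- move=> i j /sep disj v /trailP[k [b [c [kN ->]]]] /trailP[l [b' [c' [lN]]]].
  have [a0 an c0 cn] := bnd i k kN; have [a0' an' c0' cn'] := bnd j l lN.
  case/pt_inj; rewrite ?corner_lt //.
  have [x1 y1] := coordL _ (gamL i k kN).
  have [x2 y2] := coordL _ (gamL j l lN).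
  rewrite /ax /ay /idx !addSn => -[Ex] [Ey].
  have near_h x y : `|scale x - scale y| <= 2 -> `|x - y| <= e.
    rewrite scaleB normrM (gtr0_norm (_ : 0 < h^-1)) ?invr_gt0 // ler_pdivrMr //.
    by rewrite /h mulrC divfK.
  have := disj _ _ (smp01 k kN) (smp01 l lN); rewrite ltNge => /negP; apply.
  rewrite prod_normE ge_max /=; apply/andP; split; apply: near_h.
    by apply: truncn_corner Ex; apply: scale0.
  by apply: truncn_corner Ey; apply: scale0.
- move=> i j a b E.
  have smpE (c : bool) : smp (c * N)%N = c%:R.
    by rewrite /smp; case: c; rewrite ?mul1n ?mul0n ?mul0r // divff // gt_eqF.
  have aN (c : bool) : (c * N <= N)%N by case: c; rewrite ?mul1n ?mul0n.
  exists (pt n (ax i (a * N)%N + false) (ay i (a * N)%N + false)).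
    by apply/trailP; exists (a * N)%N, false, false.
  apply/trailP; exists (b * N)%N, false, false; split=> //.
  by rewrite /ax /ay !smpE E.
Qed.

End Digitization.

(** * Planar graphs are minors of grids *)

(** By the axioms of a drawing, two thirds of arcs meet only if they are
    consecutive on one arc or have the same vertex as an end, which is what
    [grid_minor_of_pieces] asks for after digitization. *)
Lemma planar_grid_minor (R : realType) (G : sgraph) : planar R G ->
  exists n (beta : gpoint n -> option G), grid_minor beta.
Proof.
move=> [pos [arc draw]].
pose E : finType := {f : {set G} | f \in edges G}.
pose is_ends (f : E) (x y : G) :=
  [/\ val f = [set x; y]%SET, arc (val f) 0 = pos x & arc (val f) 1 = pos y].
have [hd Hhd] : exists hd : E -> G, forall f, exists y, is_ends f (hd f) y.
  by apply: (fin_all_exists (P := fun f x => exists y, is_ends f x y)) => f;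
    apply: (arc_ends draw (valP f)).
have [tl Htl] := fin_all_exists (P := fun f y => is_ends f (hd f) y) Hhd.
have hd_tl f : hd f != tl f.
  have [fE _ _] := Htl f; have := card_edge (valP f).
  by rewrite fE cards2; case: eqP.
have ends_adj (x y : G) : adj x y ->
    exists f, (hd f = x /\ tl f = y) \/ (hd f = y /\ tl f = x).
  move=> xy; have xyE : [set x; y]%SET \in edges G by apply/edgesP; exists x, y.
  exists (Sub [set x; y]%SET xyE : E).
  have := Htl (Sub [set x; y]%SET xyE : E); have := hd_tl (Sub [set x; y]%SET xyE : E).
  rewrite /is_ends SubK; move: (hd _) (tl _) => a b ab [/setP EE _ _].
  have := EE a; have := EE b; rewrite !in_set2 !eqxx orbT /=.
  move=> /orP[]/eqP bE /orP[]/eqP aE; subst a b; rewrite ?eqxx // in ab *.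
    by right.
  by left.
pose gam (p : E * 'I_3) (t : R) := arc (val p.1) (((p.2 : nat)%:R + t) / 3).
have par01 (i : 'I_3) (t : R) : t \in `[0, 1] -> ((i : nat)%:R + t) / 3 \in `[0, 1].
  rewrite !in_itv /= => /andP[t0 t1].
  have i0 : (0 : R) <= (i : nat)%:R by rewrite ler0n.
  have i2 : ((i : nat)%:R : R) <= 2 by rewrite ler_nat -ltnS.
  by apply/andP; split; lra.
have gam_cont p : {within `[0, 1], continuous (gam p)}.
  apply/subspace_continuousP => s s01; apply/cvgrPdist_lt => e e0.
  have c3 : continuous (fun t : R => ((p.2 : nat)%:R + t) / 3).
    move=> t; apply: cvgM; last exact: cvg_cst.
    by apply: cvgD; [exact: cvg_cst|exact: cvg_id].
  have H := c3 s _ (curve_near (arc_continuous draw (valP p.1)) (par01 p.2 s s01) e0).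
  rewrite near_withinE; near=> t => t01.
  by have := par01 p.2 t t01; near: t; exact: H.
have gam_ends (p : E * 'I_3) (s : R) : s \in `[0, 1] -> (((p.2 : nat)%:R + s) / 3 \in `]0, 1[) \/
    (exists2 v, piece_vertex hd tl p = Some v & gam p s = pos v).
  case: p => f i s01; have := par01 i s s01; rewrite !in_itv /= => /andP[u0 u1].
  move: s01; rewrite in_itv /= => /andP[s0 s1].
  have [u0'|u0'] := eqVneq ((i : nat)%:R + s) 0.
    right; exists (hd f); last by have [_ hpos _] := Htl f; rewrite /gam /= u0' mul0r.
    rewrite /piece_vertex /=; case: i u0 u1 u0' => -[|k] //= _ _ _ H.
    have k0 : (0 : R) <= k%:R by rewrite ler0n.
    by exfalso; move: H; rewrite -natr1; lra.
  have [u1'|u1'] := eqVneq ((i : nat)%:R + s) 3.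
    right; exists (tl f); last by have [_ _ tpos] := Htl f; rewrite /gam /= u1' divff.
    by rewrite /piece_vertex /=; case: i u0 u1 u0' u1' => -[|[|k]] //= _ _ _ _ H; exfalso; lra.
  left; apply/andP; split; rewrite lt_neqAle ?u0 ?u1 andbT.
    by rewrite eq_sym mulf_neq0 // invr_neq0.
  by apply: contra_neq u1' => H; lra.
have gam_meet (p q : E * 'I_3) (s t : R) : s \in `[0, 1] -> t \in `[0, 1] -> gam p s = gam q t ->
    may_meet hd tl p q.
  move=> s01 t01 E1; have [pq|pq] := eqVneq p.1 q.1.
    left; split=> //; move: E1; rewrite /gam pq.
    move=> /(arc_inj draw (valP q.1) (par01 p.2 s s01) (par01 q.2 t t01)) E1.
    move: s01 t01; rewrite !in_itv /= => /andP[s0 s1] /andP[t0 t1].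
    by rewrite -!(ler_nat R) -!natr1; split; lra.
  have npq : val p.1 != val q.1 by rewrite (inj_eq val_inj).
  have [us|[v pv gv]] := gam_ends p s s01; have [ut|[w qw gw]] := gam_ends q t t01.
  - by case: (arcs_disjoint draw (valP p.1) (valP q.1) npq us ut).
  - by case: (arc_avoids_vertices draw (valP p.1) (v := w) us); rewrite -gw.
  - by case: (arc_avoids_vertices draw (valP q.1) (v := v) ut); rewrite -gv.
  - by right; exists v => //; rewrite qw; congr Some; apply: (pos_inj draw); rewrite -gv -gw.
have gam_vertex (p : E * 'I_3) v : piece_vertex hd tl p = Some v -> exists a : bool, gam p a%:R = pos v.
  case: p => f [[|[|[|k]]] hk] //= [<-]; have [_ hpos tpos] := Htl f.
    by exists false; rewrite /gam /= add0r mul0r.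
  by exists true; rewrite /gam /= -natr1 -addrA divff.
have [n [Q [Qint Qconn Qdisj Qend]]] := digitization gam_cont.
exists n; apply: (grid_minor_of_pieces (E := E) (hd := hd) (tl := tl) (Q := Q)) => //.
- move=> p q u up uq; apply: contrapT => N; apply: (Qdisj p q _ u up uq).
  by move=> s t s01 t01 /(gam_meet _ _ _ _ s01 t01).
- move=> p q v /gam_vertex[a Ea] /gam_vertex[b Eb]; apply: (Qend _ _ a b).
  by rewrite Ea Eb.
- move=> f i i2; apply: (Qend _ _ true false).
  by rewrite /gam /= !inordK ?addr0 ?natr1 //; lia.
Unshelve. all: end_near. Qed.

Lemma switching_equiv_refl (G : sgraph) (S : {set {set G}}) : switching_equiv S S.
Proof.
apply/existsP; exists finset.set0; apply/eqP/finset.setP => f.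
have -> : edge_cut (finset.set0 : {set G}) = finset.set0.
  by apply/finset.setP => h; rewrite !inE finset.setI0 cards0 andbF.
by rewrite /symdiff finset.setD0 finset.set0D finset.setU0.
Qed.

Lemma frustration_switching (G : sgraph) (S : {set {set G}}) (X : {set G}) :
  (frustration S <= #|symdiff S (edge_cut X)|)%N.
Proof.
rewrite /frustration; case: arg_minnP => [|S' _]; first exact: switching_equiv_refl.
by apply; apply/existsP; exists X.
Qed.

Local Close Scope ring_scope.
Local Close Scope classical_set_scope.

Theorem theorem1p6 (R : realType) (G : sgraph) (g b : nat)
  (g_gt0 : 0 < g) (planarG : planar R G) (girthG : girth_ge G g)
  (bridgesG : #|bridges G| = b) :
  max_frustration G <= (#|edges G| - b) %/ g.
Proof.
have [n [beta minor]] := planar_grid_minor planarG.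
apply/bigmax_leqP => S SE; rewrite leq_divRL // -bridgesG.
have [X HX] := grid_minor_switching minor g_gt0 girthG SE.
by apply: leq_trans HX; rewrite leq_mul2r frustration_switching orbT.
Qed.
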